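(* Let $\Omega\subset\mathbb R^n$ be a bounded domain, $1\le m\le n$, $T>0$, $Q_T=\Omega\times(0,T)$ and $\partial'Q_T=(\Omega\times\{0\})\cup(\partial\Omega\times[0,T])$. Let $v,w\in C(\bar Q_T)$ with $v\in C^{2,1}(Q_T)$ and $w\in\mathbf K^{ev}_m(Q_T)$. Assume $E_m[v]-E_m[w]\le0$ in $Q_T$ and $w-v\le0$ on $\partial'Q_T$. Then $w\le v$ in $\bar Q_T$.
   Context: For $S\in\mathrm{Sym}(n)$ and $0\le p\le n$, $T_p(S)$ is the sum of all principal $p\times p$ minors of $S$, with $T_0(S)=1$. For $u(x,t)$, $u_{xx}$ is its Hessian in $x$ and $E_p[u]=-u_t\,T_{p-1}(u_{xx})+T_p(u_{xx})$. For $s\in\mathbb R$, $S\in\mathrm{Sym}(n)$ put $E_p(s,S)=sT_{p-1}(S)+T_p(S)$ and $K^{ev}_m=\{(s,S):E_p(s,S)>0,\ p=1,\dots,m\}$. For a set $D\subset\mathbb R^n\times\mathbb R$, $\mathbf K^{ev}_m(D)$ denotes the set of $u\in C^{2,1}(D)$ such that $(-u_t,u_{xx})\in K^{ev}_m$ at every point of $D$. *)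

(* Defs.v *)
From Stdlib Require Import Reals List Arith.
Import ListNotations.
Open Scope R_scope.

(* Points of R^n are encoded as  nat -> R  whose coordinates >= n vanish. *)
Definition vec := nat -> R.
Definition in_Rn (n : nat) (x : vec) : Prop := forall i, (n <= i)%nat -> x i = 0.

Definition sum_list (l : list R) : R := fold_right Rplus 0 l.
Definition sqnorm (n : nat) (x : vec) : R := sum_list (map (fun i => x i ^ 2) (seq 0 n)).
Definition dist (n : nat) (x y : vec) : R := sqrt (sqnorm n (fun i => x i - y i)).
Definition pdist (n : nat) (x : vec) (t : R) (y : vec) (s : R) : R :=
  sqrt (sqnorm n (fun i => x i - y i) + (t - s) ^ 2).

Definition open_in (n : nat) (A : vec -> Prop) : Prop :=
  (forall x, A x -> in_Rn n x) /\
  (forall x, A x -> exists r, 0 < r /\ forall y, in_Rn n y -> dist n x y < r -> A y).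
Definition connected (n : nat) (O : vec -> Prop) : Prop :=
  forall B : vec -> Prop, (forall x, B x -> O x) -> open_in n B ->
    open_in n (fun x => O x /\ ~ B x) ->
    (forall x, ~ B x) \/ (forall x, O x -> B x).
Definition is_domain (n : nat) (O : vec -> Prop) : Prop :=
  open_in n O /\ (exists x, O x) /\ connected n O.
Definition bounded_set (n : nat) (O : vec -> Prop) : Prop :=
  exists M, forall x, O x -> dist n x (fun _ => 0) <= M.
Definition closure (n : nat) (O : vec -> Prop) (x : vec) : Prop :=
  in_Rn n x /\ forall r, 0 < r -> exists y, O y /\ dist n x y < r.
Definition boundary (n : nat) (O : vec -> Prop) (x : vec) : Prop :=
  closure n O x /\ ~ O x.

Definition QT (O : vec -> Prop) (T : R) (x : vec) (t : R) : Prop := O x /\ 0 < t < T.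
Definition QTbar (n : nat) (O : vec -> Prop) (T : R) (x : vec) (t : R) : Prop :=
  closure n O x /\ 0 <= t <= T.
Definition parbdry (n : nat) (O : vec -> Prop) (T : R) (x : vec) (t : R) : Prop :=
  (O x /\ t = 0) \/ (boundary n O x /\ 0 <= t <= T).

Definition cont_on (n : nat) (D : vec -> R -> Prop) (f : vec -> R -> R) : Prop :=
  forall x t, D x t -> forall eps, 0 < eps -> exists delta, 0 < delta /\
    forall y s, D y s -> pdist n y s x t < delta -> Rabs (f y s - f x t) < eps.

Definition shift (x : vec) (i : nat) (h : R) : vec :=
  fun j => if Nat.eqb j i then x j + h else x j.

Definition is_C21 (n : nat) (D : vec -> R -> Prop) (u : vec -> R -> R)
  (ux : nat -> vec -> R -> R) (uxx : nat -> nat -> vec -> R -> R)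
  (ut : vec -> R -> R) : Prop :=
  cont_on n D u /\ (forall i, (i < n)%nat -> cont_on n D (ux i)) /\
  (forall i j, (i < n)%nat -> (j < n)%nat -> cont_on n D (uxx i j)) /\
  cont_on n D ut /\
  forall x t, D x t ->
    (forall i, (i < n)%nat -> derivable_pt_lim (fun h => u (shift x i h) t) 0 (ux i x t)) /\
    (forall i j, (i < n)%nat -> (j < n)%nat ->
        derivable_pt_lim (fun h => ux j (shift x i h) t) 0 (uxx i j x t)) /\
    derivable_pt_lim (fun s => u x s) t (ut x t).

(* Symmetric matrices as nat -> nat -> R (entries i,j < n used). *)
Fixpoint remove_nth (k : nat) (l : list nat) : list nat :=
  match l, k with
  | [], _ => []
  | _ :: xs, O => xs
  | x :: xs, S k' => x :: remove_nth k' xs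
  end.

(* determinant of the submatrix with rows [rows] and columns [cols]
   (Laplace expansion along the first row) *)
Fixpoint detL (S : nat -> nat -> R) (rows cols : list nat) : R :=
  match rows with
  | [] => 1
  | r :: rs =>
      sum_list (map (fun k => (-1) ^ k * S r (nth k cols O) * detL S rs (remove_nth k cols))
                    (seq 0 (length cols)))
  end.

Fixpoint choose (p : nat) (l : list nat) : list (list nat) :=
  match p with
  | O => [[]]
  | S p' => match l with
            | [] => []
            | x :: xs => map (cons x) (choose p' xs) ++ choose p xs
            end
  end.

Definition Tp (n p : nat) (S : nat -> nat -> R) : R :=
  sum_list (map (fun I => detL S I I) (choose p (seq 0 n))).

Definition Ep (n p : nat) (s : R) (S : nat -> nat -> R) : R :=
  s * Tp n (p - 1) S + Tp n p S.

Definition in_Kev (n m : nat) (s : R) (S : nat -> nat -> R) : Prop :=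
  forall p, (1 <= p <= m)%nat -> 0 < Ep n p s S.

(* Main.v *)
(* If [w > v] somewhere, then [w - v - eps t] has a positive maximum at a point of
   [Q_T], where [(-v_t, v_xx) - (-w_t, w_xx)] is a positive number together with a
   positive semidefinite matrix. It remains to see that [E_m] strictly increases
   along such perturbations starting in the cone [K^ev_m]. Now [E_p (s, S)] is the
   [p]-th elementary symmetric function [e_p] of the eigenvalues of
   [A = diag (s, S)], and a positive semidefinite matrix is a sum of rank one
   matrices [u^T u], along which [e_p (A + t u^T u) = e_p + t c_p] is affine.
   The polynomial [f (X) = det (X + A + i u^T u)] has no root in the upper half
   plane, hence by Gauss-Lucas neither have its derivatives; at [0] this says
   [Im (f_(j+1) conj f_j) <= 0], that is, [c_k e_(k+1) <= e_k c_(k+1)]. As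
   [c_1 = |u|^2], positivity of [e_1, ..., e_m] yields [c_1, ..., c_m > 0]. *)

From HB Require structures.
From mathcomp Require all_boot all_order all_algebra complex ring lra zify Rstruct.
From Stdlib Require Import Reals List Arith Lra Lia.
From Stdlib Require Import Classical ClassicalChoice FunctionalExtensionality.
From Coquelicot Require Import Coquelicot.
Require Import Defs.
Open Scope R_scope.

(** * Monotonicity of the operator on its cone *)

(** Why there are no roots in the upper half plane: a root [z] of [f] is an eigenvalue of
    [-(A + i u^T u)], and pairing a row eigenvector [x] with its conjugate gives
    [Im z |x|^2 = -|x u^T|^2 <= 0]. Real roots remain possible, and coefficients are read off at the
    real point 0, so the coefficient inequality is only weak; strictness has to enter through
    [c_1 = |u|^2] and be carried upwards by [e_k > 0]. Since [e_k + c_k > 0], each rank one step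
    stays in the cone and the next vector can be added. Only the vector pointing in the [s]
    direction is known to be nonzero, its squared length being the gap between the time derivatives;
    this is what the term [eps t] provides. The other vectors need just the weak inequality.
    Derivatives are available only for [t < T]. The maximum is therefore taken over times up to some
    [t1 < T]; it may sit at [t1], where only earlier times can be compared, and the final time is
    reached by continuity. *)

Module EvolutionaryCone.
Import all_boot all_order all_algebra complex.
Import mathcomp.algebra_tactics.ring mathcomp.algebra_tactics.lra zify.
Import Rstruct.
Import Order.TTheory GRing.Theory Num.Theory.
Local Open Scope ring_scope.
Set Implicit Arguments.
Unset Strict Implicit.
Unset Printing Implicit Defensive.

(** * Polynomials without roots in the upper half plane *)

Section UpperHalfPlane.
Variable F : rcfType.
Local Notation C := (complex F).
Local Notation Re := (@complex.Re F).
Local Notation Im := (@complex.Im F).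

(* [cross a b] is the imaginary part of [a * conj b]. *)
Definition cross (a b : C) : F := Im a * Re b - Re a * Im b.

Lemma complexReM (a b : C) : Re (a * b) = Re a * Re b - Im a * Im b.
Proof. by case: a => ? ?; case: b. Qed.
Lemma complexImM (a b : C) : Im (a * b) = Re a * Im b + Im a * Re b.
Proof. by case: a => ? ?; case: b => ? ? /=; ring. Qed.
Lemma complexReD (a b : C) : Re (a + b) = Re a + Re b.
Proof. by case: a => ? ?; case: b. Qed.
Lemma complexImD (a b : C) : Im (a + b) = Im a + Im b.
Proof. by case: a => ? ?; case: b. Qed.
Lemma complexImB (a b : C) : Im (a - b) = Im a - Im b.
Proof. by case: a => ? ?; case: b. Qed.
Lemma complex_eq0P (a : C) : Re a = 0 -> Im a = 0 -> a = 0.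
Proof. by case: a => x y /= -> ->. Qed.

Definition sqmod (a : C) : F := Re a ^+ 2 + Im a ^+ 2.
Lemma sqmod_ge0 a : 0 <= sqmod a.
Proof. by rewrite addr_ge0 ?sqr_ge0. Qed.
Lemma sqmod_gt0 a : a != 0 -> 0 < sqmod a.
Proof.
move=> a0; rewrite lt0r sqmod_ge0 andbT; apply: contra a0.
rewrite paddr_eq0 ?sqr_ge0 // !sqrf_eq0 => /andP[/eqP r /eqP i].
by apply/eqP/complex_eq0P.
Qed.

Definition stable (p : {poly C}) := forall z, 0 < Im z -> p.[z] != 0.

Lemma cross_mul (d r s : C) :
  cross (r + d * s) (d * r) = sqmod d * cross s r - Im d * sqmod r.
Proof. by rewrite /cross /sqmod !(complexReM, complexImM, complexReD, complexImD); ring. Qed.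

(** [cross p' p] is [|p|^2 Im (p'/p)], and [p'/p] is the sum of the [1/(z - a)], whose imaginary
    parts are nonpositive. The form without division allows [z] to be a root, and [cross_mul] adds
    one root at a time. *)
Lemma cross_deriv_prod (rs : seq C) (z : C) :
  all (fun a => Im a <= 0) rs -> 0 <= Im z ->
  let p := \prod_(a <- rs) ('X - a%:P) in
  cross p^`().[z] p.[z] <= 0 /\
  (0 < Im z -> rs != [::] -> cross p^`().[z] p.[z] < 0).
Proof.
move=> rsP z0 /=; elim: rs rsP => [_|a rs IH /= /andP[a0 /[dup] rs0 /IH[IH1 IH2]]].
  rewrite big_nil derivC horner0; split=> //; by rewrite /cross !mul0r subrr.
rewrite big_cons derivM derivXsubC mul1r hornerD !hornerM hornerXsubC cross_mul.
set r := (\prod_(_ <- _) _).[z]; set s := (_^`()).[z] in IH1 IH2 *.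
have da : 0 <= Im (z - a) by rewrite complexImB subr_ge0 (le_trans a0).
have : sqmod (z - a) * cross s r <= 0 by rewrite mulr_ge0_le0 ?sqmod_ge0.
split; first by have := mulr_ge0 da (sqmod_ge0 r); lra.
move=> zp _.
suff : 0 < Im (z - a) * sqmod r by lra.
apply: mulr_gt0; first by rewrite complexImB subr_gt0 (le_lt_trans a0).
apply: sqmod_gt0; rewrite /r horner_prod prodf_seq_neq0; apply/allP => b brs /=.
rewrite hornerXsubC subr_eq0; apply/eqP => zb.
by move/allP: rs0 => /(_ b brs); rewrite -zb leNgt zp.
Qed.

Lemma crossZ (c a b : C) : cross (c * a) (c * b) = sqmod c * cross a b.
Proof. by rewrite /cross /sqmod !(complexReM, complexImM); ring. Qed.

(** Factor [p]: its roots lie in the closed lower half plane, and the leading coefficient only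
    scales [cross] by a positive number. The strict half excludes roots of the derivative; the weak
    half holds on the real axis and gets evaluated at 0. *)
Lemma cross_deriv_stable (p : {poly C}) (z : C) : stable p -> 0 <= Im z ->
  cross p^`().[z] p.[z] <= 0 /\
  (0 < Im z -> (1 < size p)%N -> cross p^`().[z] p.[z] < 0).
Proof.
move=> st z0; have [rs Dp] := closed_field_poly_normal p.
have [p0|p0] := eqVneq p 0.
  by rewrite p0 derivC !horner0 size_poly0 /cross !mul0r subrr.
have lp0 : lead_coef p != 0 by rewrite lead_coef_eq0.
have rs0 : all (fun a => Im a <= 0) rs.
  apply/allP => a ars; rewrite leNgt; apply/negP => /st /eqP; apply.
  rewrite Dp hornerZ; apply/eqP; rewrite mulf_eq0 -[X in _ || X]/(root _ a).
  by rewrite root_prod_XsubC ars orbT.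
have [H1 H2] := cross_deriv_prod rs0 z0.
have sp : size p = (size rs).+1.
  by rewrite Dp size_scale // size_prod_XsubC.
rewrite {1 2 4 5}Dp sp derivZ !hornerZ crossZ; split.
  by rewrite mulr_ge0_le0 ?sqmod_ge0.
move=> zp srs; rewrite pmulr_rlt0 ?sqmod_gt0 // H2 //.
by case: (rs) srs.
Qed.

(* Gauss-Lucas *)
Lemma stable_deriv (p : {poly C}) : stable p -> (1 < size p)%N -> stable p^`().
Proof.
move=> st sp z zp; apply/eqP => dp0.
have [_ /(_ zp sp)] := cross_deriv_stable st (ltW zp).
by rewrite dp0 /cross !mul0r subrr ltxx.
Qed.

Lemma crossMn (a b : C) m n : cross (a *+ m) (b *+ n) = cross a b *+ (m * n).
Proof.
have E (x : C) k : Re (x *+ k) = Re x *+ k /\ Im (x *+ k) = Im x *+ k.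
  by elim: k => [|k [r i]]; rewrite ?mulr0n // !mulrS complexReD complexImD r i.
by rewrite /cross !(proj1 (E _ _)) !(proj2 (E _ _)) !mulrnAl !mulrnAr -!mulrnA -mulrnBl mulnC.
Qed.

(** At [z = 0] the values of [p'] and [p] are the coefficients 1 and 0. Differentiation moves higher
    coefficients down, up to positive integer factors, and preserves stability. *)
Lemma stable_coef_cross (p : {poly C}) j : stable p -> cross p`_j.+1 p`_j <= 0.
Proof.
elim: j p => [|j IH] p st.
  have [+ _] := cross_deriv_stable st (lexx (Im 0)).
  by rewrite !horner_coef0 coef_deriv mulr1n.
(* Constants are treated apart: their derivative is 0, hence not stable. *)
have [sp|sp] := leqP (size p) 1.
  rewrite (nth_default _ (leq_trans sp _)) // /cross !mul0r subrr //.
have := IH _ (stable_deriv st sp).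
by rewrite !coef_deriv crossMn pmulrn_lle0.
Qed.
End UpperHalfPlane.

(** * Determinants under rank one perturbations *)

(** The perturbed matrix is the Schur complement of the corner 1 in a bordered matrix with first row
    [(1, - z u)]; the determinant is linear in that row, and [(1, - z u) = (1, 0) + z (0, - u)].
    Nothing is inverted, so the entries may be polynomials. *)
Lemma det_add_rank1 (R : comNzRingType) n (M : 'M[R]_n) (u : 'rV_n) (z : R) :
  \det (M + z *: (u^T *m u)) =
  \det M + z * \det (block_mx (0 : 'M_1) (- u) u^T M).
Proof.
have -> : \det (M + z *: (u^T *m u)) =
          \det (block_mx (1%:M : 'M_1) (- (z *: u)) u^T M).
  have -> : block_mx (1%:M : 'M_1) (- (z *: u)) u^T M =
    block_mx (1%:M : 'M_1) 0 u^T 1%:M *m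
    block_mx 1%:M (- (z *: u)) 0 (M + z *: (u^T *m u)).
    rewrite mulmx_block !mul1mx !mulmx1 !mul0mx !addr0 mulmxN scalemxAr.
    by rewrite [- _ + _]addrC addrK.
  by rewrite det_mulmx det_lblock det_ublock !det1 !mul1r.
rewrite (@determinant_multilinear _ _ _ (block_mx 1%:M 0 u^T M)
  (block_mx 0 (- u) u^T M) (lshift n ord0) 1 z).
- by rewrite det_lblock det1 !mul1r.
- rewrite /block_mx !rowKu !row_row_mx !row_id !scale_row_mx add_row_mx.
  by rewrite scaler0 scale1r addr0 scaler0 add0r scalerN.
- apply/matrixP => i j; rewrite !mxE; case: splitP => k // ik.
  by move: ik; rewrite [k]ord1 /= /bump /=.
- apply/matrixP => i j; rewrite !mxE; case: splitP => k // ik.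
  by move: ik; rewrite [k]ord1 /= /bump /=.
Qed.

Section RankOne.
Variable R : comNzRingType.

(** This is [u adj(X + A) u^T], the slope of [det (X + A + z u^T u)] in [z], written as a bordered
    determinant. *)
Definition rank1_poly n (A : 'M[R]_n) (u : 'rV_n) : {poly R} :=
  \det (block_mx (0 : 'M_1) (- map_mx polyC u) (map_mx polyC u)^T
                 ('X%:M + map_mx polyC A)).

Lemma char_polyN n (A : 'M[R]_n) :
  char_poly (- A) = \det ('X%:M + map_mx polyC A).
Proof. by rewrite /char_poly /char_poly_mx map_mxN opprK. Qed.

Lemma char_poly_add_rank1 n (A : 'M[R]_n) (u : 'rV_n) (z : R) :
  char_poly (- (A + z *: (u^T *m u))) = char_poly (- A) + z *: rank1_poly A u.
Proof.
rewrite !char_polyN map_mxD map_mxZ map_mxM -map_trmx addrA.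
by rewrite -mul_polyC; apply: det_add_rank1.
Qed.
End RankOne.

(** Used for the embedding of the reals: the slope of a real matrix is a real polynomial, so with
    [z = i] it is exactly the imaginary part. *)
Lemma map_rank1_poly (R S : comNzRingType) (f : {rmorphism R -> S}) n
    (A : 'M[R]_n) (u : 'rV_n) :
  map_poly f (rank1_poly A u) = rank1_poly (map_mx f A) (map_mx f u).
Proof.
rewrite /rank1_poly -det_map_mx map_block_mx map_mx0 map_mxN -map_trmx map_mxD.
rewrite map_scalar_mx /= map_polyX.
by congr (\det (block_mx _ (- _) _^T (_ + _))); rewrite -!map_mx_comp;
  apply: eq_map_mx => x /=; rewrite map_polyC.
Qed.

Section Entries.
Variables (R : comNzRingType) (m n : nat).
Implicit Types (X Y : 'M[R]_(m, n)).
Lemma addmx_apply X Y i j : (X + Y) i j = X i j + Y i j.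
Proof. by rewrite mxE. Qed.
Lemma oppmx_apply X i j : (- X) i j = - X i j.
Proof. by rewrite mxE. Qed.
Lemma scalemx_apply c X i j : (c *: X) i j = c * X i j.
Proof. by rewrite mxE. Qed.
End Entries.

Lemma mx11_tr_mul (R : comNzRingType) n (x y : 'rV[R]_n) :
  (x *m y^T) 0 0 = (y *m x^T) 0 0.
Proof. by rewrite -[in RHS](trmxK (y *m x^T)) [in RHS]mxE trmx_mul trmxK. Qed.

(** * Real symmetric matrices perturbed by an imaginary rank one matrix *)

Section Symmetric.
Variable F : rcfType.
Local Notation C := (complex F).
Local Notation toC := (real_complex F).

Lemma row_sqr_ge0 n (a : 'rV[F]_n) : 0 <= (a *m a^T) 0 0.
Proof. by rewrite mxE sumr_ge0 // => i _; rewrite mxE -expr2 sqr_ge0. Qed.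

Lemma row_sqr_eq0 n (a : 'rV[F]_n) : (a *m a^T) 0 0 <= 0 -> a = 0.
Proof.
move=> a0; have /eqP : (a *m a^T) 0 0 = 0 by apply: le_anti; rewrite a0 row_sqr_ge0.
rewrite mxE psumr_eq0 => [|i _]; last by rewrite mxE -expr2 sqr_ge0.
move=> /allP H; apply/rowP => i; have := H i (mem_index_enum _).
by rewrite !mxE -expr2 sqrf_eq0 => /eqP.
Qed.

Lemma stable_char_poly n (A : 'M[F]_n) (u : 'rV_n) : A^T = A ->
  stable (char_poly (- (map_mx toC A + (Complex 0 1 : C) *:
     ((map_mx toC u)^T *m map_mx toC u)))).
Proof.
move=> As z zp; rewrite -[_ == 0]/(root _ z) -eigenvalue_root_char.
apply/negP => /eigenvalueP [x xE x0].
pose a := map_mx (@complex.Re F) x; pose b := map_mx (@complex.Im F) x.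
pose U := u^T *m u.
have ReP (B : 'M[F]_n) j : complex.Re ((x *m map_mx toC B) 0 j) = (a *m B) 0 j.
  rewrite !mxE (big_morph (@complex.Re F) (@complexReD F) (erefl _)).
  by apply: eq_bigr => k _; rewrite !mxE complexReM /= mulr0 subr0.
have ImP (B : 'M[F]_n) j : complex.Im ((x *m map_mx toC B) 0 j) = (b *m B) 0 j.
  rewrite !mxE (big_morph (@complex.Im F) (@complexImD F) (erefl _)).
  by apply: eq_bigr => k _; rewrite !mxE complexImM /= mulr0 add0r.
move: xE; rewrite map_trmx -map_mxM mulmxN mulmxDr -scalemxAr -/U.
move: (x *m map_mx toC A) (x *m map_mx toC U) (ReP A) (ReP U) (ImP A) (ImP U).
move=> P Q PA QU PA' QU' /rowP E.
pose p := complex.Re z; pose q := complex.Im z.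
have Ej j : complex.Re (P 0 j) - complex.Im (Q 0 j) = - (p * a 0 j - q * b 0 j) /\
            complex.Im (P 0 j) + complex.Re (Q 0 j) = - (q * a 0 j + p * b 0 j).
  have := E j; rewrite !mxE /p /q.
  case: (P 0 j) => ? ?; case: (Q 0 j) => ? ?; case: (x 0 j) => ? ?; case: (z) => ? ?.
  move=> /eqP; rewrite eq_complex /= => /andP[/eqP H1 /eqP H2]. split; lra.
have rowE (X Y Z W : 'rV[F]_n) : (forall j, X 0 j + Y 0 j = - (Z 0 j + W 0 j)) -> X + Y = - (Z + W).
  by move=> H; apply/rowP => j; have := H j; rewrite !mxE.
have E1 : a *m A + - (b *m U) = - (p *: a + - (q *: b)).
  apply: rowE => j; have := (Ej j).1; rewrite PA QU' => H.
  by rewrite !oppmx_apply H !scalemx_apply.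
have E2 : b *m A + a *m U = - (q *: a + p *: b).
  apply: rowE => j; have := (Ej j).2; rewrite PA' QU => H.
  by rewrite H !scalemx_apply.
have T (c d : 'rV[F]_n) : (c *m A *m d^T) 0 0 = (d *m A *m c^T) 0 0.
  rewrite -[in RHS](trmxK (d *m A *m c^T)) [in RHS]mxE !trmx_mul As trmxK mulmxA //.
have UP (c : 'rV[F]_n) : 0 <= (c *m U *m c^T) 0 0.
  by rewrite /U mulmxA -mulmxA -[u in X in _ *m (X *m _)]trmxK -trmx_mul row_sqr_ge0.
(* Pairing [E1] with [b] and [E2] with [a] and subtracting takes the imaginary part of the Hermitian
   pairing with [x = a + i b]: the terms in [A] and in [p] cancel by symmetry, leaving
   [a U a^T + b U b^T = - q (|a|^2 + |b|^2)]. *)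
have := congr1 (fun M => (M *m b^T) 0 0) E1.
have := congr1 (fun M => (M *m a^T) 0 0) E2.
rewrite !(mulmxDl, mulNmx) -!scalemxAl => H2 H1; move: H1 H2.
rewrite !(oppmx_apply, addmx_apply, scalemx_apply) (T b a) (mx11_tr_mul b a) => H1 H2.
have ab0 : q * ((a *m a^T) 0 0 + (b *m b^T) 0 0) <= 0.
  by have := UP a; have := UP b; lra.
rewrite pmulr_rle0 // in ab0.
have Ha := row_sqr_ge0 a; have Hb := row_sqr_ge0 b.
have a0 : a = 0 by apply: row_sqr_eq0; lra.
have b0 : b = 0 by apply: row_sqr_eq0; lra.
case/eqP: x0; apply/rowP => j; rewrite mxE; apply: complex_eq0P.
  by move/rowP/(_ j): a0; rewrite !mxE.
by move/rowP/(_ j): b0; rewrite !mxE.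
Qed.

(* This is [Im (f_(j+1) * conj f_j) <= 0] for the characteristic polynomial [f]
   of [-(A + i u^T u)], whose real and imaginary parts are the two polynomials. *)
Lemma char_poly_rank1_coef n (A : 'M[F]_n) (u : 'rV_n) j : A^T = A ->
  (rank1_poly A u)`_j.+1 * (char_poly (- A))`_j <=
  (char_poly (- A))`_j.+1 * (rank1_poly A u)`_j.
Proof.
move=> As; have := stable_coef_cross j (stable_char_poly u As).
rewrite char_poly_add_rank1 -map_mxN -map_char_poly -map_rank1_poly /cross.
rewrite !coefD !coefZ !coef_map !(complexReD, complexImD, complexReM, complexImM) /=.
lra.
Qed.
End Symmetric.

(** * Elementary symmetric functions of eigenvalues on the Garding cone *)

Section Garding.
Variable F : rcfType.

(* The [k]-th elementary symmetric function of the eigenvalues of [A]. *)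
Definition eigsym n (A : 'M[F]_n) k : F := (char_poly (- A))`_(n - k).

Definition garding n m (A : 'M[F]_n) := forall k, (0 < k <= m)%N -> 0 < eigsym A k.

Lemma eigsym0 n (A : 'M[F]_n) : eigsym A 0 = 1.
Proof.
have /monicP := char_poly_monic (- A).
by rewrite /eigsym subn0 lead_coefE size_char_poly.
Qed.

Lemma eigsym1 n (A : 'M[F]_n.+1) : eigsym A 1 = \tr A.
Proof.
by rewrite /eigsym subn1 char_poly_trace // linearN opprK.
Qed.

(** The number [c_k]. The difference [n - k] is truncated, as in [eigsym], so the statements on
    signs keep [k] within the dimension. *)
Definition eigsym_slope n (A : 'M[F]_n) u k : F := (rank1_poly A u)`_(n - k).

Lemma eigsym_add_rank1 n (A : 'M[F]_n) (u : 'rV_n) k :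
  eigsym (A + u^T *m u) k = eigsym A k + eigsym_slope A u k.
Proof.
have := char_poly_add_rank1 A u 1; rewrite !scale1r /eigsym => ->.
by rewrite coefD.
Qed.

Lemma eigsym_slope0 n (A : 'M[F]_n) u : eigsym_slope A u 0 = 0.
Proof.
have := eigsym_add_rank1 A u 0; rewrite !eigsym0 => H.
by apply: (addrI 1); rewrite -H addr0.
Qed.

Lemma eigsym_slope1 n (A : 'M[F]_n.+1) u : eigsym_slope A u 1 = (u *m u^T) 0 0.
Proof.
have := eigsym_add_rank1 A u 1; rewrite !eigsym1 mxtraceD => /addrI <-.
by rewrite mxtrace_mulC trace_mx11.
Qed.

(** A decomposition of a positive semidefinite matrix may contain zero vectors, so a version without
    [u != 0] is needed. In [c_(k+1) e_(k+2) <= e_(k+1) c_(k+2)] the left side is nonnegative and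
    [e_(k+1)] can be divided out. *)
Lemma eigsym_slope_ge0 n m (A : 'M[F]_n.+1) u : A^T = A -> garding m A ->
  forall k, (k <= m)%N -> (k <= n.+1)%N -> 0 <= eigsym_slope A u k.
Proof.
move=> As Ag; elim=> [|[|k] IH] km kn; first by rewrite eigsym_slope0.
  by rewrite eigsym_slope1 row_sqr_ge0.
have := char_poly_rank1_coef u (n.+1 - k.+2) As.
have -> : (n.+1 - k.+2).+1 = (n.+1 - k.+1)%N by lia.
rewrite -/(eigsym A k.+1) -/(eigsym A k.+2) -/(eigsym_slope A u k.+1) -/(eigsym_slope A u k.+2).
have e1 := Ag k.+1 ltac:(lia); have e2 := Ag k.+2 ltac:(lia).
have := IH ltac:(lia) ltac:(lia); nra.
Qed.

(** The induction starts at 1, because [c_0 = 0] carries no strictness; from [c_1 = |u|^2 > 0] on,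
    the left side of the coefficient inequality is positive. *)
Lemma eigsym_slope_gt0 n m (A : 'M[F]_n.+1) u : A^T = A -> garding m A -> u != 0 ->
  forall k, (0 < k <= m)%N -> (k <= n.+1)%N -> 0 < eigsym_slope A u k.
Proof.
move=> As Ag u0; elim=> [//|[|k] IH] km kn.
  rewrite eigsym_slope1 ltNge; apply: contra u0 => /row_sqr_eq0 ->; exact: eqxx.
have := char_poly_rank1_coef u (n.+1 - k.+2) As.
have -> : (n.+1 - k.+2).+1 = (n.+1 - k.+1)%N by lia.
rewrite -/(eigsym A k.+1) -/(eigsym A k.+2) -/(eigsym_slope A u k.+1) -/(eigsym_slope A u k.+2).
have e1 := Ag k.+1 ltac:(lia); have e2 := Ag k.+2 ltac:(lia).
have c1 := IH ltac:(lia) ltac:(lia).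
have := mulr_gt0 c1 e2; nra.
Qed.

Definition psd n (P : 'M[F]_n) := P^T = P /\ forall x : 'rV_n, 0 <= (x *m P *m x^T) 0 0.

(* Induction on [n] by Schur complement. *)
Lemma psd_sum_rank1 n (P : 'M[F]_n) : psd P ->
  exists us : seq 'rV[F]_n, P = \sum_(u <- us) u^T *m u.
Proof.
elim: n P => [|n IH]; first by move=> P _; exists [::]; apply/matrixP; case.
rewrite -[n.+1]/(1 + n)%N => P; rewrite -[P]submxK.
move: (ulsubmx _) (ursubmx _) (dlsubmx _) (drsubmx _) => a b c D.
rewrite /psd tr_block_mx => -[/eq_block_mx [aT cT bT DT] pos].
have {}pos (s : F) (y : 'rV_n) :
  0 <= s ^+ 2 * a 0 0 + (2 * s * (b *m y^T) 0 0) + (y *m D *m y^T) 0 0.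
  have := pos (row_mx (s%:M : 'M_1) y).
  rewrite mul_row_block tr_row_mx mul_row_col !mulmxDl tr_scalar_mx -bT.
  rewrite !mul_scalar_mx !mul_mx_scalar -!scalemxAl !(addmx_apply, scalemx_apply).
  rewrite (mx11_tr_mul y b); lra.
have block0 (us : seq 'rV[F]_n) (E : 'M[F]_n) : E = \sum_(u <- us) u^T *m u ->
    block_mx (0 : 'M_1) 0 0 E = \sum_(u <- map (row_mx (0 : 'M_1)) us) u^T *m u.
  elim: us E => [|u us IHu] E ->; first by rewrite /= !big_nil block_mx0.
  rewrite /= !big_cons -(IHu _ (erefl _)) tr_row_mx trmx0 mul_col_row add_block_mx.
  by rewrite !(mul0mx, mulmx0, addr0).
have a0 : 0 <= a 0 0.
  by have := pos 1 0; rewrite trmx0 !mulmx0 [fun_of_matrix 0 _ _]mxE; lra.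
have [a00|an0] := eqVneq (a 0 0) 0.
  have b0 : b = 0.
    apply: row_sqr_eq0; rewrite leNgt; apply/negP => bp.
    (* With a zero corner the form is affine in [s]; this [s] makes its value at [(s, b)] equal to
       -1. *)
    have := pos (- ((b *m D *m b^T) 0 0 + 1) / (2 * (b *m b^T) 0 0)) b.
    rewrite a00 mulr0 add0r.
    set s := _ / _; set d := (b *m D *m b^T) 0 0.
    have -> : 2 * s * (b *m b^T) 0 0 = - (d + 1).
      by rewrite /s -/d; field; apply: lt0r_neq0.
    lra.
  have [|us Dus] := IH D.
    by split=> // y; have := pos 0 y; rewrite expr0n mulr0 !mul0r !add0r.
  exists (map (row_mx 0) us); rewrite -(block0 _ _ Dus).
  by rewrite -bT b0 trmx0; congr block_mx; apply/matrixP => i j; rewrite !ord1 a00 mxE.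
have ap : 0 < a 0 0 by rewrite lt_def an0.
pose r := Num.sqrt (a 0 0).
have rr : r * r = a 0 0 by rewrite -expr2 sqr_sqrtr.
have r0 : r != 0 by rewrite gt_eqF // sqrtr_gt0.
have [|us Dus] := IH (D - (a 0 0)^-1 *: (b^T *m b)).
  split=> [|y]; first by rewrite linearB linearZ /= trmx_mul trmxK DT.
  (* Completing the square: this [s] minimises the form for fixed [y], and the minimum is the form
     of the Schur complement. *)
  have := pos (- (b *m y^T) 0 0 / a 0 0) y.
  rewrite mulmxBr mulmxBl -scalemxAr -scalemxAl mulmxA -(mulmxA _ b).
  rewrite !(addmx_apply, oppmx_apply, scalemx_apply).
  rewrite [(_ *m (b *m y^T)) 0 0]mxE big_ord1 (mx11_tr_mul y b).
  move: ((b *m y^T) 0 0) (a 0 0) an0 => t s s0.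
  by congr (0 <= _); field.
exists (row_mx r%:M (r^-1 *: b) :: map (row_mx 0) us); rewrite big_cons -(block0 _ _ Dus).
rewrite tr_row_mx mul_col_row add_block_mx tr_scalar_mx !addr0.
have -> : (r^-1 *: b)^T = r^-1 *: b^T by rewrite linearZ.
rewrite -scalar_mxM rr !mul_scalar_mx !mul_mx_scalar -scalemxAl -scalemxAr !scalerA.
rewrite mulfV // ?mulVf // !scale1r bT -invfM rr addrC subrK.
by congr block_mx; apply/matrixP => i j; rewrite !ord1 mxE.
Qed.

Lemma psd_tr_mul n (u : 'rV[F]_n) : (u^T *m u)^T = u^T *m u.
Proof. by rewrite trmx_mul trmxK. Qed.

Lemma garding_add_rank1 n m (A : 'M[F]_n.+1) (u : 'rV_n.+1) : (m <= n.+1)%N ->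
  A^T = A -> garding m A -> garding m (A + u^T *m u).
Proof.
move=> mn As Ag k km; rewrite eigsym_add_rank1.
by apply: ltr_wpDr; [apply: (eigsym_slope_ge0 _ As Ag); lia | apply: Ag].
Qed.

Lemma eigsym_add_psd n m (A P : 'M[F]_n.+1) : (m <= n.+1)%N ->
  A^T = A -> psd P -> garding m A -> eigsym A m <= eigsym (A + P) m.
Proof.
move=> mn As /psd_sum_rank1[us ->]; elim: us A As => [|u us IH] A As Ag.
  by rewrite big_nil addr0.
rewrite big_cons addrA; apply: le_trans (IH _ _ _).
- by rewrite eigsym_add_rank1 lerDl; apply: (eigsym_slope_ge0 _ As Ag).
- by rewrite linearD /= As psd_tr_mul.
- exact: garding_add_rank1.
Qed.

(** The nonzero [u] is added before [P]: it gives the strict increase and leaves the matrix in the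
    cone, where the weak bound covers [P]. *)
Lemma eigsym_add_rank1_psd n m (A P : 'M[F]_n.+1) (u : 'rV_n.+1) : (0 < m <= n.+1)%N ->
  A^T = A -> psd P -> u != 0 -> garding m A ->
  eigsym A m < eigsym (A + u^T *m u + P) m.
Proof.
move=> /andP[m0 mn] As Ps u0 Ag.
have /lt_le_trans -> // : eigsym A m < eigsym (A + u^T *m u) m.
  by rewrite eigsym_add_rank1 ltrDl; apply: (eigsym_slope_gt0 As Ag); rewrite ?m0 /=.
apply: eigsym_add_psd => //; first by rewrite linearD /= As psd_tr_mul.
exact: garding_add_rank1.
Qed.
End Garding.

(** * Principal minors as coefficients of [det (X + M)] *)

Section PrincipalMinors.
Variable R : comNzRingType.
Implicit Type M : nat -> nat -> R.

Definition pminor M (n : nat) (s : nat -> nat) : R :=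
  \det (\matrix_(i < n, j < n) M (s i) (s j)).

Lemma eq_pminor M M' n s s' :
  (forall i j, (i < n)%N -> (j < n)%N -> M (s i) (s j) = M' (s' i) (s' j)) ->
  pminor M n s = pminor M' n s'.
Proof. by move=> E; congr (\det _); apply/matrixP => i j; rewrite !mxE E. Qed.

(** Linearity in row [i0]: the added row is [z] times a unit vector, and its determinant is the
    cofactor at [(i0, i0)], with sign +1. The hypothesis on [s] ensures that no other row or column
    is touched. *)
Lemma pminor_add_diag M (z : R) n s (i0 : 'I_n.+1) :
  (forall i, (i <= n)%N -> s i = s i0 -> i = i0) ->
  pminor (fun i j => M i j + (if (i == s i0) && (j == s i0) then z else 0)) n.+1 s =
  pminor M n.+1 s + z * pminor M n (fun i => s (bump i0 i)).
Proof.
move=> s_inj; rewrite /pminor.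
have sE (i : 'I_n.+1) : (s i == s i0) = (i == i0).
  apply/eqP/eqP => [/s_inj E|-> //]; apply: val_inj; apply: E; exact: leq_ord.
have lF (i : 'I_n) : (lift i0 i == i0) = false by rewrite eq_sym (negPf (neq_lift _ _)).
pose B := \matrix_(i < n.+1, j < n.+1) M (s i) (s j).
pose Cm := \matrix_(i < n.+1, j < n.+1) (if i == i0 then (j == i0)%:R else M (s i) (s j)).
rewrite (@determinant_multilinear _ _ _ B Cm i0 1 z).
- rewrite mul1r; congr (_ + z * _).
  rewrite (expand_det_row _ i0) (bigD1 i0) //= big1 ?addr0 => [|j /negPf ji].
    rewrite mxE !eqxx mul1r /cofactor addnn -signr_odd odd_double expr0 mul1r.
    congr (\det _); apply/matrixP => i j; rewrite !mxE.
    by rewrite lF.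
  by rewrite mxE eqxx ji mul0r.
- apply/rowP => j; rewrite !mxE eqxx sE mul1r eqxx /=.
  by case: eqP => _; rewrite ?mulr1 ?mulr0.
- by apply/matrixP => i j; rewrite !mxE !sE lF /= addr0.
- by apply/matrixP => i j; rewrite !mxE !sE lF /= addr0.
Qed.

Definition lminor M (l : seq nat) : R := pminor M (size l) (nth 0%N l).

Lemma lminor_add_diag M (z : R) K x l : x \notin K ++ l ->
  lminor (fun i j => M i j + (if (i == x) && (j == x) then z else 0)) (K ++ x :: l) =
  lminor M (K ++ x :: l) + z * lminor M (K ++ l).
Proof.
move=> xKl; rewrite /lminor.
have -> : size (K ++ x :: l) = (size (K ++ l)).+1 by rewrite !size_cat /= addnS.
have Kn : (size K < (size (K ++ l)).+1)%N by rewrite size_cat; lia.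
pose i0 := Ordinal Kn.
have si0 : nth 0%N (K ++ x :: l) i0 = x by rewrite nth_cat ltnn subnn.
have nE i : nth 0%N (K ++ x :: l) (bump i0 i) = nth 0%N (K ++ l) i.
  rewrite !nth_cat /bump /=; case: (ltnP i (size K)) => iK; first by rewrite iK.
  by rewrite add1n ltnNge leqW //= subSn.
rewrite -{1 2}si0 pminor_add_diag.
  by congr (_ + _ * _); apply: eq_pminor => i j _ _; rewrite !nE.
move=> i il; rewrite si0 => ix; case: (eqVneq i i0) => // ni.
case/negP: xKl; rewrite -ix.
have -> : i = bump i0 (unbump i0 i) by rewrite unbumpKcond (negPf ni).
rewrite nE mem_nth //.
have Kn' := Kn; move: ni il Kn'; rewrite /unbump -[i0 : nat]/(size K).
by case: ltngtP => //= *; lia.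
Qed.

Lemma choose0 (l : seq nat) : Defs.choose 0 l = [:: [::]].
Proof. by case: l. Qed.

Lemma size_choose p (l : seq nat) : (size l < p)%N -> Defs.choose p l = [::].
Proof.
elim: l p => [|x l IH] [|p] //=; rewrite ltnS => lp.
by rewrite !IH // leqW.
Qed.

Lemma List_mapE (A B : Type) (f : A -> B) l : List.map f l = map f l.
Proof. by elim: l => //= a l ->. Qed.

(* [K] collects the indices already decided to keep their original diagonal
   entry; it makes the induction on [l] go through. *)
Lemma lminor_shift M (z : R) K l : uniq (K ++ l) ->
  lminor (fun i j => M i j + (if (i == j) && (i \in l) then z else 0)) (K ++ l) =
  \sum_(p < (size l).+1) z ^+ (size l - p) *
     \sum_(J <- Defs.choose p l) lminor M (K ++ J).
Proof.
elim: l K => [|x l IH] K uKl.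
  rewrite big_ord1 /= big_seq1 mul1r; apply: eq_pminor => i j _ _.
  by rewrite andbF addr0.
have /and3P[xKl uKl' xl] : [&& x \notin K ++ l, uniq (K ++ l) & x \notin l].
  by move: uKl; rewrite !cat_uniq /= mem_cat !negb_or => /and4P[-> /andP[-> ->] -> ->].
(* The index [x] is either kept, and then joins [K], or deleted at the price of a factor [z]: these
   are the two branches of [choose]. *)
transitivity (lminor (fun i j => M i j + (if (i == j) && (i \in l) then z else 0)) (K ++ x :: l) +
  z * lminor (fun i j => M i j + (if (i == j) && (i \in l) then z else 0)) (K ++ l)).
  rewrite -lminor_add_diag //; apply: eq_pminor => i j _ _; rewrite -addrA; congr (_ + _).
  rewrite in_cons; have [->|] := eqVneq (nth _ _ i) x.
    by rewrite /= (negPf xl) andbT andbF add0r eq_sym.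
  by move=> _ /=; rewrite addr0.
rewrite -cat_rcons !IH ?cat_rcons //= [in RHS]big_ord_recl.
rewrite [X in z * X]big_ord_recl /= !big_seq1 subn0 mulrDr mulrA -exprS subn0.
rewrite choose0 big_seq1 addrCA; congr (_ + _).
under [in RHS]eq_bigr => i _ do
  rewrite [bump _ _]add1n [(0 + i)%N]add0n subSS big_cat List_mapE big_map mulrDr.
rewrite big_split /=; congr (_ + _).
  by apply: eq_bigr => i _; congr (_ * _); apply: eq_bigr => J _; rewrite cat_rcons.
rewrite big_ord_recr /= size_choose // big_nil mulr0 addr0 big_distrr /=.
apply: eq_bigr => i _; rewrite mulrA -exprS [bump _ _]add1n.
by rewrite -subSn ?subSS.
Qed.
End PrincipalMinors.

Lemma lminor_polyC (R : comNzRingType) (M : nat -> nat -> R) l :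
  lminor (fun i j => (M i j)%:P) l = (lminor M l)%:P.
Proof.
by rewrite /lminor /pminor -det_map_mx; congr (\det _); apply/matrixP => i j; rewrite !mxE.
Qed.

(** * Identification of [Tp] and [Ep] with coefficients of characteristic polynomials *)

Lemma sum_listE (A : Type) (f : A -> R) (l : seq A) :
  sum_list (List.map f l) = \sum_(x <- l) f x.
Proof. by elim: l => [|x l IH]; rewrite ?big_nil ?big_cons //= -IH. Qed.

Lemma List_seqE m n : List.seq m n = iota m n.
Proof. by elim: n m => //= n IH m; rewrite IH. Qed.

Lemma sum_list_seq (f : nat -> R) n :
  sum_list (List.map f (List.seq 0 n)) = \sum_(i < n) f i.
Proof. by rewrite sum_listE List_seqE -[in iota 0 n](subn0 n) big_mkord. Qed.

Lemma List_nthE (T : Type) (x : T) l i : List.nth i l x = nth x l i.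
Proof. by elim: l i => [|y l IH] [|i] //=. Qed.

Lemma nth_remove_nth k l i : nth 0%N (remove_nth k l) i = nth 0%N l (bump k i).
Proof.
elim: l k i => [|x l IH] [|k] [|i] //=; first by rewrite nth_nil.
by rewrite IH /bump ltnS; case: (k <= i)%N.
Qed.

Lemma size_remove_nth k l : (k < size l)%N -> size (remove_nth k l) = (size l).-1.
Proof. by elim: l k => [|x l IH] [|k] //= kl; rewrite IH // prednK //; case: (l) kl. Qed.

Lemma detLE (S : nat -> nat -> R) rows cols n :
  size rows = n -> size cols = n ->
  detL S rows cols = \det (\matrix_(i < n, j < n) S (nth 0%N rows i) (nth 0%N cols j)).
Proof.
elim: n rows cols => [|n IH] [|r rs] cols //=; first by rewrite det_mx00.
move=> [rsn] cn; rewrite (expand_det_row _ ord0).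
rewrite -[length cols]/(size cols) cn sum_list_seq; apply: eq_bigr => k _.
rewrite !mxE /= List_nthE /cofactor add0n (IH rs) //; last by rewrite size_remove_nth cn.
rewrite RpowE !RmultE [X in X * _]mulrC -mulrA; congr (_ * (_ * _)).
by congr (\det _); apply/matrixP => i j; rewrite !mxE nth_remove_nth.
Qed.

(** Take [z = 'X] in [lminor_shift] over polynomials: the minors are then constants, so the subsets
    of size [p] contribute exactly in degree [n - p]. *)
Lemma Tp_char_poly n p (S : nat -> nat -> R) : (p <= n)%N ->
  Tp n p S = (char_poly (- \matrix_(i < n, j < n) S i j))`_(n - p).
Proof.
move=> pn; pose M i j := (S i j)%:P : {poly R}.
have -> : char_poly (- \matrix_(i < n, j < n) S i j) =
  lminor (fun i j => M i j + (if (i == j) && (i \in iota 0 n) then 'X else 0)) ([::] ++ iota 0 n).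
  rewrite char_polyN /lminor /= size_iota; congr (\det _).
  apply/matrixP => i j; rewrite !mxE !nth_iota // !add0n mem_iota /= ltn_ord andbT addrC.
  by rewrite -val_eqE; case: eqP.
rewrite lminor_shift ?cat0s ?iota_uniq // size_iota coef_sum.
rewrite (bigD1 (Ordinal (pn : p < n.+1)%N)) //=.
rewrite [X in _ + X]big1 ?addr0 => [|i ip].
  rewrite coefXnM ltnn subnn /=.
  rewrite coef_sum /Tp sum_listE List_seqE; apply: eq_bigr => J _.
  by rewrite (detLE _ (erefl _) (erefl _)) lminor_polyC coefC eqxx.
have {}ip : (i : nat) != p by apply: contra ip => /eqP ip; apply/eqP/val_inj.
rewrite coefXnM; case: ltnP => // le.
have -> : (n - p - (n - i) = (i - p).-1.+1)%N by have := ltn_ord i; lia.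
by rewrite coef_sum big1_seq // => J _; rewrite lminor_polyC coefC.
Qed.

Definition natmx n (S : nat -> nat -> R) : 'M[R]_n := \matrix_(i < n, j < n) S i j.
(* [Ep] of [(s, S)] is the [p]-th elementary symmetric function of [diag(s, S)],
   so the evolutionary cone is a slice of a Garding cone in dimension [n + 1]. *)
Definition evmx n (s : R) (S : 'M[R]_n) : 'M[R]_(1 + n) := block_mx s%:M 0 0 S.

(** The corner contributes a factor [X + s] to the characteristic polynomial: [X] times the
    coefficient of degree [n - p] gives [T_p], and [s] times that of degree [n - (p - 1)] gives
    [s T_(p-1)]. *)
Lemma Ep_eigsym n p s (S : nat -> nat -> R) : (0 < p <= n)%N ->
  Ep n p s S = eigsym (evmx s (natmx n S)) p.
Proof.
case: p => // p /andP[_ pn].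
have -> : eigsym (evmx s (natmx n S)) p.+1 =
    (('X + s%:P) * char_poly (- natmx n S))`_(1 + n - p.+1).
  rewrite /eigsym !char_polyN /evmx map_block_mx !map_mx0 scalar_mx_block add_block_mx !addr0.
  by rewrite det_ublock map_scalar_mx -raddfD /= det_scalar1.
rewrite mulrDl coefD coefXM coefCM /Ep RplusE RmultE.
have -> : (1 + n - p.+1 == 0)%N = false by lia.
rewrite !Tp_char_poly -?/(natmx n S); try lia.
rewrite addrC; congr (_`__ + _ * _`__); rewrite -?minusE; lia.
Qed.

Lemma Ep_lt n m s s' (S S' : nat -> nat -> R) : (0 < m <= n)%N ->
  (forall i j, (i < n)%N -> (j < n)%N -> S i j = S j i) ->
  (forall i j, (i < n)%N -> (j < n)%N -> S' i j = S' j i) ->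
  (forall x : nat -> R, 0 <= \sum_(i < n) \sum_(j < n) x i * x j * (S' i j - S i j)) ->
  s < s' -> in_Kev n m s S -> Ep n m s S < Ep n m s' S'.
Proof.
move=> mn Ssym S'sym pos ss' Kev.
pose A := evmx s (natmx n S).
pose P := evmx 0 (natmx n S' - natmx n S).
(* The increase of [s] is a rank one term that is nonzero by [s < s']; the increase of the matrix
   goes into [P]. *)
pose u : 'rV[R]_(1 + n) := row_mx (Num.sqrt (s' - s))%:M 0.
have trS (T : nat -> nat -> R) : (forall i j, (i < n)%N -> (j < n)%N -> T i j = T j i) ->
    (natmx n T)^T = natmx n T.
  by move=> Tsym; apply/matrixP => i j; rewrite !mxE Tsym.
have trE t (T : 'M_n) : T^T = T -> (evmx t T)^T = evmx t T.
  by move=> TT; rewrite /evmx tr_block_mx tr_scalar_mx !trmx0 TT.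
have E : evmx s' (natmx n S') = A + u^T *m u + P.
  rewrite /A /P /u /evmx tr_row_mx trmx0 mul_col_row !add_block_mx tr_scalar_mx.
  rewrite !(mulmx0, mul0mx, addr0) -scalar_mxM -expr2 sqr_sqrtr ?subr_ge0 ?ltW //.
  by rewrite -!raddfD /= addr0 addrC subrK addrC subrK.
rewrite !Ep_eigsym // E; apply: eigsym_add_rank1_psd => //.
- by case/andP: mn => ->; lia.
- exact/trE/trS.
- split; first by apply: trE; rewrite linearB /= !trS.
  suff H (y : 'rV[R]_(1 + n)) : 0 <= (y *m P *m y^T) 0 0 by exact: H.
  rewrite -[y]hsubmxK; move: (lsubmx y) (rsubmx y) => a b.
  rewrite /P /evmx mul_row_block tr_row_mx mul_row_col.
  rewrite !mulmx0 mul_mx_scalar scale0r !add0r mul0mx add0r.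
  rewrite mxE.
  pose x i := if insub i is Some k then b 0 k else 0.
  have xE (k : 'I_n) : x k = b 0 k by rewrite /x valK.
  suff -> : \sum_(j < n) (b *m (natmx n S' - natmx n S)) 0 j * b^T j 0 =
     \sum_(i < n) \sum_(j < n) x i * x j * (S' i j - S i j) by [].
  rewrite exchange_big /=; apply: eq_bigr => j _; rewrite !mxE big_distrl /=.
  by apply: eq_bigr => i _; rewrite !mxE !xE mulrAC.
- apply/eqP => /(congr1 (fun v : 'rV_(1 + n) => lsubmx v 0 0)).
  rewrite row_mxKl !mxE /= => /eqP; rewrite mulr1n sqrtr_eq0 subr_le0 leNgt ss' //.
- move=> k km; rewrite -Ep_eigsym; last lia.
  by apply/RltP/Kev; lia.
Qed.

(** The interface to the analytic half: the same monotonicity with standard orders and list sums. *)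
Lemma Ep_increasing (n m : nat) s s' (S S' : nat -> nat -> R) :
  Peano.le 1 m -> Peano.le m n ->
  (forall i j, Peano.lt i n -> Peano.lt j n -> S i j = S j i) ->
  (forall i j, Peano.lt i n -> Peano.lt j n -> S' i j = S' j i) ->
  (forall x : nat -> R, Rle 0
     (sum_list (List.map (fun i => sum_list (List.map (fun j =>
         Rmult (Rmult (x i) (x j)) (Rminus (S' i j) (S i j))) (List.seq 0 n))) (List.seq 0 n)))) ->
  Rlt s s' -> in_Kev n m s S -> Rlt (Ep n m s S) (Ep n m s' S').
Proof.
move=> m1 mn Ssym S'sym pos /RltP ss' Kev; apply/RltP; apply: Ep_lt => //.
- by lia.
- by move=> i j ? ?; apply: Ssym; lia.
- by move=> i j ? ?; apply: S'sym; lia.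
move=> x; have /RleP := pos x.
rewrite sum_list_seq.
by under eq_bigr => i _ do rewrite sum_list_seq.
Qed.

End EvolutionaryCone.

(** * The comparison principle *)

Definition vsum (n : nat) (f : nat -> R) : R := sum_list (map f (seq 0 n)).

Lemma sum_list_app l l' : sum_list (l ++ l') = sum_list l + sum_list l'.
Proof. induction l as [|a l IH]; simpl; [lra | rewrite IH; lra]. Qed.

Lemma vsum_S n f : vsum (S n) f = vsum n f + f n.
Proof.
  unfold vsum. rewrite seq_S, map_app, sum_list_app. simpl. lra.
Qed.

Lemma vsum_ext n f g : (forall i, (i < n)%nat -> f i = g i) -> vsum n f = vsum n g.
Proof.
  induction n as [|n IH]; intros E; [reflexivity|].
  rewrite !vsum_S, IH, E; auto.
Qed.

Lemma vsum_nonneg n f : (forall i, (i < n)%nat -> 0 <= f i) -> 0 <= vsum n f.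
Proof.
  induction n as [|n IH]; intros H; [unfold vsum; simpl; lra|].
  rewrite vsum_S. assert (0 <= f n) by (apply H; lia).
  assert (0 <= vsum n f) by (apply IH; auto). lra.
Qed.

Lemma vsum_le_const n f c :
  (forall i, (i < n)%nat -> f i <= c) -> vsum n f <= INR n * c.
Proof.
  induction n as [|n IH]; intros H; [unfold vsum; simpl; lra|].
  rewrite vsum_S, S_INR. assert (f n <= c) by (apply H; lia).
  assert (vsum n f <= INR n * c) by (apply IH; auto). lra.
Qed.

Lemma vsum_ge_term n f i :
  (forall j, (j < n)%nat -> 0 <= f j) -> (i < n)%nat -> f i <= vsum n f.
Proof.
  induction n as [|n IH]; intros H Hi; [lia|].
  rewrite vsum_S. assert (0 <= f n) by (apply H; lia).
  destruct (Nat.eq_dec i n) as [->|ne].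
  - assert (0 <= vsum n f) by (apply vsum_nonneg; auto). lra.
  - assert (f i <= vsum n f) by (apply IH; [auto|lia]). lra.
Qed.

Lemma vsum_scal n c f : vsum n (fun i => c * f i) = c * vsum n f.
Proof. induction n as [|n IH]; [unfold vsum; simpl; lra | rewrite !vsum_S, IH; lra]. Qed.

(** Boxes in place of Euclidean balls: openness and continuity are transferred to them once, and
    then most estimates are coordinatewise. *)
Definition near (n : nat) (r : R) (y x : vec) : Prop :=
  forall i, (i < n)%nat -> Rabs (y i - x i) < r.

Lemma coord_le_dist n x y i : (i < n)%nat -> Rabs (x i - y i) <= dist n x y.
Proof.
  intros Hi. unfold dist. rewrite <- sqrt_Rsqr_abs. apply sqrt_le_1_alt.
  unfold Rsqr. replace ((x i - y i) * (x i - y i)) with ((x i - y i) ^ 2) by ring.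
  apply (vsum_ge_term n (fun i => (x i - y i) ^ 2)); auto.
  intros j _. apply pow2_ge_0.
Qed.

Lemma sqnorm_near n r y x : near n r y x -> sqnorm n (fun i => y i - x i) <= INR n * r ^ 2.
Proof.
  intros H. apply vsum_le_const. intros i Hi. apply pow_maj_Rabs, Rlt_le, H, Hi.
Qed.

Lemma near_pdist n r : 0 < r -> exists d, 0 < d /\
  forall y s x t, near n d y x -> Rabs (s - t) < d -> pdist n y s x t < r.
Proof.
  intros Hr. assert (Hn := pos_INR n).
  (* With this [d] the squared distance is at most [(n + 1) d^2 < (n + 2)^2 d^2 = r^2]. *)
  exists (r / (INR n + 2)). assert (Hd : 0 < r / (INR n + 2)) by (apply Rdiv_lt_0_compat; lra).
  split; [exact Hd|]. intros y s x t Hy Hs. unfold pdist.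
  rewrite <- (sqrt_pow2 r) by lra. apply sqrt_lt_1_alt.
  assert (H1 := sqnorm_near _ _ _ _ Hy).
  assert (H2 : (s - t) ^ 2 <= (r / (INR n + 2)) ^ 2) by (apply pow_maj_Rabs; lra).
  split.
  - assert (0 <= sqnorm n (fun i => y i - x i)).
    { apply vsum_nonneg. intros; apply pow2_ge_0. }
    assert (H3 := pow2_ge_0 (s - t)). lra.
  - assert (E : r = (INR n + 2) * (r / (INR n + 2))) by (field; lra).
    set (d := r / (INR n + 2)) in *. rewrite E.
    assert (0 < d ^ 2) by (apply pow_lt; auto). nra.
Qed.

Lemma near_dist n r : 0 < r -> exists d, 0 < d /\
  forall y x, near n d y x -> dist n y x < r.
Proof.
  intros Hr. destruct (near_pdist n r Hr) as (d & Hd & H).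
  exists d. split; [exact Hd|]. intros y x Hy.
  specialize (H y 0 x 0 Hy). unfold pdist in H. unfold dist.
  replace (sqnorm n (fun i => y i - x i))
    with (sqnorm n (fun i => y i - x i) + (0 - 0) ^ 2) by ring.
  apply H. rewrite Rminus_0_r, Rabs_R0. exact Hd.
Qed.

Lemma cont_on_near n D f x t : cont_on n D f -> D x t -> forall eps, 0 < eps ->
  exists d, 0 < d /\ forall y s, D y s -> near n d y x -> Rabs (s - t) < d ->
    Rabs (f y s - f x t) < eps.
Proof.
  intros Hc Hx eps He. destruct (Hc x t Hx eps He) as (r & Hr & H).
  destruct (near_pdist n r Hr) as (d & Hd & H'). exists d. split; auto.
Qed.

Lemma open_in_near n A x : open_in n A -> A x ->
  exists d, 0 < d /\ forall y, in_Rn n y -> near n d y x -> A y.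
Proof.
  intros [_ Ho] Hx. destruct (Ho x Hx) as (r & Hr & H).
  destruct (near_dist n r Hr) as (d & Hd & H'). exists d. split; auto.
  intros y Hy Hn. apply H; auto.
  replace (dist n x y) with (dist n y x); [auto|].
  unfold dist, sqnorm. f_equal. apply vsum_ext. intros; ring.
Qed.

(** * Compactness in space-time *)

(** Subsequences are only asked to satisfy [k <= phi k], which suffices for limits and is stable
    under composition. *)
Lemma Un_cv_subseq u l (phi : nat -> nat) :
  (forall k, (k <= phi k)%nat) -> Un_cv u l -> Un_cv (fun k => u (phi k)) l.
Proof.
  intros Hp Hu eps He. destruct (Hu eps He) as [N HN]. exists N.
  intros k Hk. apply HN. specialize (Hp k). lia.
Qed.

Lemma bounded_subseq (u : nat -> R) M : (forall k, Rabs (u k) <= M) ->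
  exists phi l, (forall k, (k <= phi k)%nat) /\ Un_cv (fun k => u (phi k)) l.
Proof.
  intros Hu.
  destruct (Bolzano_Weierstrass u (fun c => - M <= c <= M)) as [l Hl].
  - apply compact_P3.
  - intros k. specialize (Hu k). revert Hu. unfold Rabs. destruct (Rcase_abs (u k)); lra.
  - assert (Hch : forall k, exists p, (k <= p)%nat /\ Rabs (u p - l) < / (INR k + 1)).
    { intros k. assert (Hk := pos_INR k).
      assert (Hp : 0 < / (INR k + 1)) by (apply Rinv_0_lt_compat; lra).
      destruct (Hl (disc l (mkposreal _ Hp)) k) as (p & H1 & H2).
      - exists (mkposreal _ Hp). intros z Hz. exact Hz.
      - exists p. split; [exact H1|exact H2]. }
    apply choice in Hch. destruct Hch as [phi Hphi].
    exists phi, l. split; [intros k; apply Hphi|].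
    intros eps He. destruct (archimed_cor1 eps He) as (N & HN & HN0).
    exists N. intros k Hk. unfold Rdist. eapply Rlt_trans; [apply Hphi|].
    eapply Rle_lt_trans; [|exact HN]. apply Rinv_le_contravar; [apply lt_0_INR; lia|].
    apply le_INR in Hk. lra.
Qed.

Lemma bounded_subseq_coords n (x : nat -> vec) M :
  (forall k i, (i < n)%nat -> Rabs (x k i) <= M) ->
  exists phi l, (forall k, (k <= phi k)%nat) /\
    forall i, (i < n)%nat -> Un_cv (fun k => x (phi k) i) (l i).
Proof.
  induction n as [|n IH]; intros Hx.
  - exists (fun k => k), (fun _ => 0). split; [auto|intros; lia].
  - destruct IH as (phi & l & Hphi & Hl); [auto|].
    destruct (bounded_subseq (fun k => x (phi k) n) M) as (psi & c & Hpsi & Hc); [auto|].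
    exists (fun k => phi (psi k)), (fun i => if Nat.eqb i n then c else l i). split.
    + intros k. specialize (Hphi (psi k)). specialize (Hpsi k). lia.
    + intros i Hi. destruct (Nat.eqb_spec i n) as [->|ne]; [exact Hc|].
      apply (Un_cv_subseq (fun k => x (phi k) i)); [exact Hpsi|apply Hl; lia].
Qed.

Lemma Un_cv_unif n (x : nat -> vec) (l : vec) d : 0 < d ->
  (forall i, (i < n)%nat -> Un_cv (fun k => x k i) (l i)) ->
  exists N, forall k, (N <= k)%nat -> near n d (x k) l.
Proof.
  intros Hd. induction n as [|n IH]; intros H.
  - exists O. intros k _ i Hi. lia.
  - destruct IH as [N1 H1]; [auto|]. destruct (H n (Nat.lt_succ_diag_r n) d Hd) as [N2 H2].
    exists (Nat.max N1 N2). intros k Hk i Hi.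
    destruct (Nat.eq_dec i n) as [->|ne]; [apply H2; lia|apply H1; lia].
Qed.

Section Maximum.
Variables (n : nat) (D : vec -> R -> Prop) (f : vec -> R -> R) (M : R).
Hypothesis D_bounded :
  forall x t, D x t -> Rabs t <= M /\ forall i, (i < n)%nat -> Rabs (x i) <= M.
Hypothesis D_closed : forall x t, in_Rn n x ->
  (forall d, 0 < d -> exists y s, D y s /\ near n d y x /\ Rabs (s - t) < d) -> D x t.
Hypothesis f_cont : cont_on n D f.

Lemma compact_subseq (x : nat -> vec) (t : nat -> R) : (forall k, D (x k) (t k)) ->
  exists phi x0 t0, (forall k, (k <= phi k)%nat) /\ D x0 t0 /\
    Un_cv (fun k => f (x (phi k)) (t (phi k))) (f x0 t0).
Proof.
  intros Hx.
  destruct (bounded_subseq_coords n x M) as (phi & l & Hphi & Hl).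
  { intros k. apply (D_bounded (x k) (t k)), Hx. }
  destruct (bounded_subseq (fun k => t (phi k)) M) as (psi & t0 & Hpsi & Ht).
  { intros k. apply (D_bounded (x (phi k)) (t (phi k))), Hx. }
  (* The limits control only the coordinates below [n]; the others are set to 0 so that [x0] lies in
     [R^n], as [D_closed] requires. *)
  set (x0 := fun i => if Nat.ltb i n then l i else 0).
  assert (Hx0 : in_Rn n x0).
  { intros i Hi. unfold x0. destruct (Nat.ltb_spec i n); [lia|reflexivity]. }
  assert (Hl' : forall i, (i < n)%nat -> Un_cv (fun k => x (phi (psi k)) i) (x0 i)).
  { intros i Hi. unfold x0. destruct (Nat.ltb_spec i n); [|lia].
    apply (Un_cv_subseq (fun k => x (phi k) i)); auto. }
  assert (Hnear : forall d, 0 < d -> exists N, forall k, (N <= k)%nat ->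
            near n d (x (phi (psi k))) x0 /\ Rabs (t (phi (psi k)) - t0) < d).
  { intros d Hd. destruct (Un_cv_unif n (fun k => x (phi (psi k))) x0 d Hd Hl') as [N1 H1].
    destruct (Ht d Hd) as [N2 H2]. exists (Nat.max N1 N2). intros k Hk.
    split; [apply H1; lia|apply H2; lia]. }
  assert (HD : D x0 t0).
  { apply D_closed; auto. intros d Hd. destruct (Hnear d Hd) as [N HN].
    exists (x (phi (psi N))), (t (phi (psi N))). split; [apply Hx|apply HN; lia]. }
  exists (fun k => phi (psi k)), x0, t0. split; [|split; [exact HD|]].
  - intros k. specialize (Hphi (psi k)). specialize (Hpsi k). lia.
  - intros eps He. destruct (cont_on_near n D f x0 t0 f_cont HD eps He) as (d & Hd & H).
    destruct (Hnear d Hd) as [N HN]. exists N. intros k Hk.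
    apply H; [apply Hx|apply HN|apply HN]; lia.
Qed.

(** [compact_subseq] serves twice: on points with [f > k] to bound [f] above, then on points with
    [f > s - 1/(k + 1)] to attain the supremum [s]. *)
Lemma maximum_attained : (exists x t, D x t) ->
  exists x t, D x t /\ forall y s, D y s -> f y s <= f x t.
Proof.
  intros (xa & ta & Ha).
  set (E := fun z => exists x t, D x t /\ z = f x t).
  assert (HE : bound E).
  { apply NNPP. intros Hb.
    assert (Hk : forall k : nat, exists p : vec * R,
      D (fst p) (snd p) /\ INR k < f (fst p) (snd p)).
    { intros k. apply NNPP. intros Hn. apply Hb. exists (INR k).
      intros z (x & t & Hxt & ->). apply Rnot_lt_le. intros Hlt. apply Hn.
      exists (x, t). auto. }
    apply choice in Hk. destruct Hk as [p Hp].
    destruct (compact_subseq (fun k => fst (p k)) (fun k => snd (p k)))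
      as (phi & x0 & t0 & H1 & H2 & H3).
    { intros k; apply Hp. }
    destruct (H3 1 Rlt_0_1) as [N HN].
    destruct (INR_unbounded (f x0 t0 + 1)) as [K HK].
    specialize (HN (Nat.max N K) (Nat.le_max_l N K)).
    unfold Rdist in HN. apply Rabs_def2 in HN.
    destruct (Hp (phi (Nat.max N K))) as [_ Hf].
    assert (INR K <= INR (phi (Nat.max N K))).
    { apply le_INR. specialize (H1 (Nat.max N K)). lia. }
    lra. }
  destruct (completeness E HE) as [s [Hub Hlub]].
  { exists (f xa ta), xa, ta. auto. }
  assert (Hk : forall k : nat, exists p : vec * R,
      D (fst p) (snd p) /\ s - / (INR k + 1) < f (fst p) (snd p)).
  { intros k. apply NNPP. intros Hn.
    assert (s <= s - / (INR k + 1)).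
    { apply Hlub. intros z (x & t & Hxt & ->). apply Rnot_lt_le. intros Hlt. apply Hn.
      exists (x, t). auto. }
    assert (0 < / (INR k + 1)) by (apply Rinv_0_lt_compat; assert (H0 := pos_INR k); lra).
    lra. }
  apply choice in Hk. destruct Hk as [p Hp].
  destruct (compact_subseq (fun k => fst (p k)) (fun k => snd (p k)))
      as (phi & x0 & t0 & H1 & H2 & H3).
  { intros k; apply Hp. }
  exists x0, t0. split; [exact H2|]. intros y r Hy.
  apply Rle_trans with s; [apply Hub; exists y, r; auto|].
  apply Rnot_lt_le. intros Hlt.
  assert (He : 0 < (s - f x0 t0) / 2) by lra.
  destruct (H3 _ He) as [N HN]. destruct (archimed_cor1 _ He) as (K & HK & HK0).
  specialize (HN (Nat.max N K) (Nat.le_max_l N K)).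
  unfold Rdist in HN. apply Rabs_def2 in HN.
  destruct (Hp (phi (Nat.max N K))) as [_ Hf].
  assert (/ (INR (phi (Nat.max N K)) + 1) <= / INR K).
  { apply Rinv_le_contravar; [apply lt_0_INR; lia|].
    assert (INR K <= INR (phi (Nat.max N K))).
    { apply le_INR. specialize (H1 (Nat.max N K)). lia. }
    lra. }
  lra.
Qed.
End Maximum.

(** * One-variable derivatives at a maximum *)

Lemma derivable_pt_lim_shift0 (g : R -> R) a l :
  derivable_pt_lim (fun h => g (a + h)) 0 l <-> derivable_pt_lim g a l.
Proof.
  unfold derivable_pt_lim. split; intros H eps He;
    destruct (H eps He) as [d Hd]; exists d; intros h h0 hd; specialize (Hd h h0 hd);
    rewrite ?Rplus_0_l, ?Rplus_0_r in *; exact Hd.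
Qed.

Lemma derivable_pt_lim_eq_near (g g' : R -> R) a l r : 0 < r ->
  (forall h, Rabs (h - a) < r -> g h = g' h) ->
  derivable_pt_lim g a l -> derivable_pt_lim g' a l.
Proof.
  intros Hr E H eps He. destruct (H eps He) as [d Hd].
  assert (Hm : 0 < Rmin d r) by (apply Rmin_pos; [apply cond_pos|exact Hr]).
  exists (mkposreal _ Hm). simpl. intros h h0 hd.
  rewrite <- !E.
  - apply Hd; auto. eapply Rlt_le_trans; [exact hd|apply Rmin_l].
  - replace (a - a) with 0 by ring. rewrite Rabs_R0. exact Hr.
  - replace (a + h - a) with h by ring. eapply Rlt_le_trans; [exact hd|apply Rmin_r].
Qed.

(** [g1] is differentiable only at 0. There [g1] vanishes, so [c > 0] would make [g1] positive just
    to the right of 0, and the mean value theorem would give [g h > g 0]. *)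
Lemma second_derivative_max (g g1 : R -> R) c r : 0 < r ->
  (forall h, Rabs h < r -> derivable_pt_lim g h (g1 h)) ->
  derivable_pt_lim g1 0 c -> (forall h, Rabs h < r -> g h <= g 0) -> c <= 0.
Proof.
  intros Hr Hg Hg1 Hmax.
  assert (H0 : derivable_pt_lim g 0 (g1 0)) by (apply Hg; rewrite Rabs_R0; exact Hr).
  assert (E0 : g1 0 = 0).
  { assert (pr : derivable_pt g 0) by (exists (g1 0); exact H0).
    rewrite <- (derive_pt_eq_0 g 0 (g1 0) pr H0).
    apply (deriv_maximum g (- r) r 0 pr); try lra.
    intros x H1 H2. apply Hmax. apply Rabs_def1; lra. }
  apply Rnot_lt_le. intros Hc.
  destruct (Hg1 (c / 2)) as [d Hd]; [lra|].
  set (h := Rmin (d / 2) (r / 2)).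
  assert (Hd0 := cond_pos d).
  assert (Hh : 0 < h) by (apply Rmin_pos; lra).
  assert (Hhd : h <= d / 2) by apply Rmin_l.
  assert (Hhr : h <= r / 2) by apply Rmin_r.
  destruct (MVT_cor2 g g1 0 h Hh) as (x & Hx & Hxh).
  { intros x Hx. apply Hg. apply Rabs_def1; lra. }
  assert (Hm := Hmax h). specialize (Hm ltac:(apply Rabs_def1; lra)).
  specialize (Hd x ltac:(lra) ltac:(apply Rabs_def1; lra)).
  rewrite Rplus_0_l, E0, Rminus_0_r in Hd. apply Rabs_def2 in Hd.
  assert (Hq : 0 < g1 x / x) by lra.
  assert (0 < g1 x).
  { replace (g1 x) with (g1 x / x * x) by (field; lra). apply Rmult_lt_0_compat; lra. }
  assert (0 < g1 x * (h - 0)) by (apply Rmult_lt_0_compat; lra).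
  lra.
Qed.

(** One-sided, because the maximum point may lie at the last time of the truncated cylinder. *)
Lemma derivative_at_left_max (g : R -> R) a l r : 0 < r -> derivable_pt_lim g a l ->
  (forall s, a - r < s < a -> g s <= g a) -> 0 <= l.
Proof.
  intros Hr Hg Hmax. apply Rnot_lt_le. intros Hl.
  destruct (Hg (- l / 2)) as [d Hd]; [lra|].
  set (h := Rmin (d / 2) (r / 2)).
  assert (Hd0 := cond_pos d).
  assert (Hh : 0 < h) by (apply Rmin_pos; lra).
  assert (Hhd : h <= d / 2) by apply Rmin_l.
  assert (Hhr : h <= r / 2) by apply Rmin_r.
  specialize (Hd (- h) ltac:(lra) ltac:(apply Rabs_def1; lra)).
  apply Rabs_def2 in Hd. specialize (Hmax (a + - h) ltac:(lra)).
  assert (0 <= (g (a + - h) - g a) / - h).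
  { replace ((g (a + - h) - g a) / - h) with ((g a - g (a + - h)) * / h) by (field; lra).
    apply Rmult_le_pos; [lra|]. apply Rlt_le, Rinv_0_lt_compat, Hh. }
  lra.
Qed.

(** * Chain rule and Hessian on a time slice *)

Definition space_cont (n : nat) (O : vec -> Prop) (g : vec -> R) : Prop :=
  forall x, O x -> forall eps, 0 < eps -> exists d, 0 < d /\
    forall y, O y -> near n d y x -> Rabs (g y - g x) < eps.

Definition partials (n : nat) (O : vec -> Prop) (U : vec -> R) (G : nat -> vec -> R) : Prop :=
  forall x i, O x -> (i < n)%nat -> derivable_pt_lim (fun h => U (shift x i h)) 0 (G i x).

(* Only the first [k] coordinates move, which lets the chain rule be proved
   one coordinate at a time. *)
Definition line (k : nat) (x xi : vec) (h : R) : vec :=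
  fun j => if Nat.ltb j k then x j + h * xi j else x j.

Lemma shift_in_Rn n x i h : in_Rn n x -> (i < n)%nat -> in_Rn n (shift x i h).
Proof.
  intros Hx Hi j Hj. unfold shift. destruct (Nat.eqb_spec j i); [lia|auto].
Qed.

Lemma line_in_Rn n k x xi h : in_Rn n x -> (k <= n)%nat -> in_Rn n (line k x xi h).
Proof.
  intros Hx Hi j Hj. unfold line. destruct (Nat.ltb_spec j k); [lia|auto].
Qed.

Lemma shift_shift x i a b : shift (shift x i a) i b = shift x i (a + b).
Proof.
  extensionality j. unfold shift. destruct (Nat.eqb j i); ring.
Qed.

Lemma shift_0 x i : shift x i 0 = x.
Proof. extensionality j. unfold shift. destruct (Nat.eqb j i); ring. Qed.

Lemma shift_comm x i j a b : shift (shift x i a) j b = shift (shift x j b) i a.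
Proof.
  extensionality k. unfold shift. destruct (Nat.eqb k i), (Nat.eqb k j); ring.
Qed.

Lemma line_S k x xi h : line (S k) x xi h = shift (line k x xi h) k (h * xi k).
Proof.
  extensionality j. unfold shift, line.
  destruct (Nat.ltb_spec j (S k)), (Nat.ltb_spec j k), (Nat.eqb_spec j k);
    try lia; subst; ring.
Qed.

Lemma line_line n x xi a b : line n (line n x xi a) xi b = line n x xi (a + b).
Proof.
  extensionality j. unfold line. destruct (Nat.ltb j n); ring.
Qed.

Lemma line_0 n x xi : line n x xi 0 = x.
Proof. extensionality j. unfold line. destruct (Nat.ltb j n); ring. Qed.

Lemma bounded_coords n (xi : vec) : exists B, 0 < B /\ forall i, (i < n)%nat -> Rabs (xi i) <= B.
Proof.
  exists (vsum n (fun i => Rabs (xi i)) + 1). split.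
  - assert (0 <= vsum n (fun i => Rabs (xi i))) by (apply vsum_nonneg; intros; apply Rabs_pos). lra.
  - intros i Hi. assert (H := vsum_ge_term n (fun i => Rabs (xi i)) i).
    simpl in H. specialize (H (fun j _ => Rabs_pos _) Hi). lra.
Qed.

Lemma near_shift_line n k x xi B h c : (k < n)%nat ->
  (forall i, (i < n)%nat -> Rabs (xi i) <= B) -> Rabs c <= Rabs h * B ->
  forall d, Rabs h * B < d -> near n d (shift (line k x xi h) k c) x.
Proof.
  intros Hk HB Hc d Hd i Hi. unfold shift, line.
  assert (Rabs (h * xi i) <= Rabs h * B).
  { rewrite Rabs_mult. apply Rmult_le_compat_l; [apply Rabs_pos|auto]. }
  destruct (Nat.ltb_spec i k), (Nat.eqb_spec i k); try lia.
  - replace (x i + h * xi i - x i) with (h * xi i) by ring. lra.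
  - replace (x i + c - x i) with c by ring. lra.
  - replace (x i - x i) with 0 by ring. rewrite Rabs_R0.
    assert (0 <= Rabs c) by apply Rabs_pos. lra.
Qed.

Section ChainRule.
Variables (n : nat) (O : vec -> Prop) (U : vec -> R) (G : nat -> vec -> R).
Hypothesis O_open : open_in n O.
Hypothesis U_partials : partials n O U G.
Hypothesis G_cont : forall i, (i < n)%nat -> space_cont n O (G i).

Lemma partials_at y i a : O (shift y i a) -> (i < n)%nat ->
  derivable_pt_lim (fun b => U (shift y i b)) a (G i (shift y i a)).
Proof.
  intros Hy Hi. apply derivable_pt_lim_shift0.
  assert (H := U_partials _ i Hy Hi).
  apply (derivable_pt_lim_eq_near (fun h => U (shift (shift y i a) i h)) _ 0 _ 1 Rlt_0_1); auto.
  intros h _. now rewrite shift_shift.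
Qed.

(** Only coordinate [k] differs between the two points, so the mean value theorem turns the
    increment into [h * xi k] times [G k] at an intermediate point; continuity of [G k] at [x] does
    the rest. *)
Lemma chain_rule_step k x xi : (k < n)%nat -> O x ->
  derivable_pt_lim (fun h => U (line (S k) x xi h) - U (line k x xi h)) 0 (xi k * G k x).
Proof.
  intros Hk Hx eps He.
  destruct (bounded_coords n xi) as (B & HB0 & HB).
  destruct (open_in_near n O x O_open Hx) as (r & Hr & HO).
  assert (He' : 0 < eps / (B + 1)) by (apply Rdiv_lt_0_compat; lra).
  destruct (G_cont k Hk x Hx _ He') as (d & Hd & HG).
  set (m := Rmin r d). assert (Hm : 0 < m) by (apply Rmin_pos; auto).
  assert (HmB : 0 < m / B) by (apply Rdiv_lt_0_compat; auto).
  exists (mkposreal _ HmB). simpl. intros h h0 Hh.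
  assert (HhB : Rabs h * B < m).
  { replace m with (m / B * B) by (field; lra). apply Rmult_lt_compat_r; auto. }
  assert (HhO : forall c, Rabs c <= Rabs h * B ->
     O (shift (line k x xi h) k c) /\ near n d (shift (line k x xi h) k c) x).
  { intros c Hc. split.
    - apply HO.
      + apply shift_in_Rn; auto. apply line_in_Rn; [apply O_open; auto|lia].
      + apply near_shift_line with B; auto. eapply Rlt_le_trans; [exact HhB|apply Rmin_l].
    - apply near_shift_line with B; auto. eapply Rlt_le_trans; [exact HhB|apply Rmin_r]. }
  assert (Hxi : Rabs (h * xi k) <= Rabs h * B).
  { rewrite Rabs_mult. apply Rmult_le_compat_l; [apply Rabs_pos|auto]. }
  assert (Hbtw : forall c, Rmin 0 (h * xi k) <= c <= Rmax 0 (h * xi k) -> Rabs c <= Rabs h * B).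
  { intros c Hc. eapply Rle_trans; [|exact Hxi].
    unfold Rmin, Rmax in Hc. destruct (Rle_dec 0 (h * xi k)) in Hc.
    - rewrite !Rabs_pos_eq; lra.
    - rewrite !Rabs_left1; lra. }
  set (y := line k x xi h) in *.
  destruct (MVT_gen (fun b => U (shift y k b)) 0 (h * xi k) (fun b => G k (shift y k b)))
    as (c & Hc & E).
  - intros c Hc. apply is_derive_Reals, partials_at; auto. apply HhO, Hbtw. lra.
  - intros c Hc. apply derivable_continuous_pt. exists (G k (shift y k c)).
    apply partials_at; auto. apply HhO, Hbtw. lra.
  - destruct (HhO c (Hbtw c Hc)) as [HcO Hcn].
    rewrite Rplus_0_l. rewrite !line_0, line_S. fold y.
    replace (U (shift y k (h * xi k)) - U y) with (G k (shift y k c) * (h * xi k)).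
    2: { rewrite Rminus_0_r in E. rewrite <- E, shift_0. reflexivity. }
    replace ((G k (shift y k c) * (h * xi k) - (U x - U x)) / h - xi k * G k x)
      with (xi k * (G k (shift y k c) - G k x)) by (field; auto).
    rewrite Rabs_mult. specialize (HG _ HcO Hcn).
    apply Rle_lt_trans with (B * (eps / (B + 1))).
    + apply Rmult_le_compat; try apply Rabs_pos; [auto|lra].
    + apply Rmult_lt_reg_r with (B + 1); [lra|].
      replace (B * (eps / (B + 1)) * (B + 1)) with (B * eps) by (field; lra). nra.
Qed.

Lemma chain_rule x xi : O x ->
  derivable_pt_lim (fun h => U (line n x xi h)) 0 (vsum n (fun i => xi i * G i x)).
Proof.
  intros Hx. assert (H : forall k, (k <= n)%nat ->
    derivable_pt_lim (fun h => U (line k x xi h)) 0 (vsum k (fun i => xi i * G i x))).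
  { induction k as [|k IH]; intros Hk.
    - exact (derivable_pt_lim_const (U x) 0).
    - rewrite vsum_S.
      apply (derivable_pt_lim_eq_near
        (fun h => U (line k x xi h) + (U (line (S k) x xi h) - U (line k x xi h))) _ 0 _ 1 Rlt_0_1).
      + intros h _. ring.
      + apply derivable_pt_lim_plus with (f1 := fun h => U (line k x xi h)).
        * apply IH; lia.
        * apply chain_rule_step; auto. }
  apply H; auto.
Qed.

Lemma chain_rule_at x xi h : O (line n x xi h) ->
  derivable_pt_lim (fun h => U (line n x xi h)) h (vsum n (fun i => xi i * G i (line n x xi h))).
Proof.
  intros Hx. apply derivable_pt_lim_shift0.
  apply (derivable_pt_lim_eq_near (fun b => U (line n (line n x xi h) xi b)) _ 0 _ 1 Rlt_0_1).
  - intros b _. now rewrite line_line.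
  - apply chain_rule, Hx.
Qed.

Lemma line_in_open x xi : O x -> exists r, 0 < r /\ forall h, Rabs h < r -> O (line n x xi h).
Proof.
  intros Hx. destruct (bounded_coords n xi) as (B & HB0 & HB).
  destruct (open_in_near n O x O_open Hx) as (r & Hr & HO).
  exists (r / B). split; [apply Rdiv_lt_0_compat; auto|]. intros h Hh.
  apply HO.
  - apply line_in_Rn; [apply O_open; auto|lia].
  - intros i Hi. unfold line. destruct (Nat.ltb_spec i n); [|lia].
    replace (x i + h * xi i - x i) with (h * xi i) by ring. rewrite Rabs_mult.
    apply Rle_lt_trans with (Rabs h * B).
    + apply Rmult_le_compat_l; [apply Rabs_pos|auto].
    + replace r with (r / B * B) by (field; lra). apply Rmult_lt_compat_r; auto.
Qed.
End ChainRule.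

Lemma derivable_pt_lim_vsum m (f : nat -> R -> R) a (l : nat -> R) :
  (forall i, (i < m)%nat -> derivable_pt_lim (f i) a (l i)) ->
  derivable_pt_lim (fun h => vsum m (fun i => f i h)) a (vsum m l).
Proof.
  induction m as [|m IH]; intros H.
  - exact (derivable_pt_lim_const 0 a).
  - rewrite vsum_S.
    apply (derivable_pt_lim_eq_near (fun h => vsum m (fun i => f i h) + f m h) _ a _ 1 Rlt_0_1).
    + intros h _. now rewrite vsum_S.
    + apply derivable_pt_lim_plus with (f1 := fun h => vsum m (fun i => f i h)); auto.
Qed.

(** Along the line [x + h xi], the chain rule for [U] gives the first derivative, and the chain rule
    for each [G j] gives the second one at 0, which is the quadratic form of the Hessian. *)
Lemma hessian_max n O U G H x xi : open_in n O -> partials n O U G ->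
  (forall j, (j < n)%nat -> partials n O (G j) (fun i => H i j)) ->
  (forall i, (i < n)%nat -> space_cont n O (G i)) ->
  (forall i j, (i < n)%nat -> (j < n)%nat -> space_cont n O (H i j)) ->
  O x -> (forall y, O y -> U y <= U x) ->
  vsum n (fun j => vsum n (fun i => xi i * xi j * H i j x)) <= 0.
Proof.
  intros Ho HU HG Gc Hc Hx Hmax.
  destruct (line_in_open n O Ho x xi Hx) as (r & Hr & HO).
  apply (second_derivative_max (fun h => U (line n x xi h))
    (fun h => vsum n (fun i => xi i * G i (line n x xi h))) _ r Hr).
  - intros h Hh. apply chain_rule_at with O; auto.
  - apply derivable_pt_lim_vsum with (f := fun i h => xi i * G i (line n x xi h)).
    intros j Hj.
    replace (vsum n (fun i => xi i * xi j * H i j x)) with (xi j * vsum n (fun i => xi i * H i j x)).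
    + apply derivable_pt_lim_scal with (f := fun h => G j (line n x xi h)).
      apply (chain_rule n O (G j) (fun i => H i j)); auto.
    + rewrite <- vsum_scal. apply vsum_ext. intros; ring.
  - intros h Hh. rewrite line_0. auto.
Qed.

(** [is_C21] does not postulate symmetry, while the monotonicity lemma works with symmetric
    matrices. It is the theorem of Schwarz on the coordinate plane [p] through [x] in the directions
    [i] and [j]. *)
Lemma hessian_sym n O U G H x i j : open_in n O -> partials n O U G ->
  (forall j, (j < n)%nat -> partials n O (G j) (fun i => H i j)) ->
  (forall i j, (i < n)%nat -> (j < n)%nat -> space_cont n O (H i j)) ->
  O x -> (i < n)%nat -> (j < n)%nat -> H i j x = H j i x.
Proof.
  intros Ho HU HG Hc Hx Hi Hj.
  destruct (Nat.eq_dec i j) as [->|ne]; [reflexivity|].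
  destruct (open_in_near n O x Ho Hx) as (r & Hr & HO).
  set (p := fun a b => shift (shift x i a) j b).
  assert (Hnear : forall d a b, Rabs a < d -> Rabs b < d -> near n d (p a b) x).
  { intros d a b Ha Hb k Hk. unfold p, shift. assert (0 <= Rabs a) by apply Rabs_pos.
    destruct (Nat.eqb_spec k j), (Nat.eqb_spec k i); subst; try congruence.
    - replace (x j + b - x j) with b by ring. lra.
    - replace (x i + a - x i) with a by ring. lra.
    - replace (x k - x k) with 0 by ring. rewrite Rabs_R0. lra. }
  assert (HpO : forall a b, Rabs a < r -> Rabs b < r -> O (p a b)).
  { intros a b Ha Hb. apply HO; auto. unfold p. repeat apply shift_in_Rn; auto. apply Ho, Hx. }
  assert (Dj : forall (V : vec -> R) K, partials n O V K -> forall a b, Rabs a < r -> Rabs b < r ->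
    is_derive (fun z => V (p a z)) b (K j (p a b))).
  { intros V K HV a b Ha Hb. apply is_derive_Reals. apply (partials_at n O V K HV); auto.
    apply HpO; auto. }
  assert (Di : forall (V : vec -> R) K, partials n O V K -> forall a b, Rabs a < r -> Rabs b < r ->
    is_derive (fun z => V (p z b)) a (K i (p a b))).
  { intros V K HV a b Ha Hb. apply is_derive_Reals.
    apply (derivable_pt_lim_eq_near (fun z => V (shift (shift x j b) i z)) _ a _ 1 Rlt_0_1).
    - intros z _. unfold p. now rewrite shift_comm.
    - unfold p. rewrite shift_comm. apply (partials_at n O V K HV); auto.
      rewrite shift_comm. apply HpO; auto. }
  assert (Hloc : forall a, Rabs a < r -> locally a (fun z => Rabs z < r)).
  { intros a Ha. assert (Hra : 0 < r - Rabs a) by lra. exists (mkposreal _ Hra).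
    assert (Ht : forall z : R, Rabs (z + - a) < r - Rabs a -> Rabs z < r).
    { intros z Hz. assert (Ht := Rabs_triang (z + - a) a).
      replace (z + - a + a) with z in Ht by ring. lra. }
    intros z Hz. apply Ht. exact Hz. }
  assert (Eij : forall a b, Rabs a < r -> Rabs b < r ->
    is_derive (fun z => Derive (fun t => U (p z t)) b) a (H i j (p a b))).
  { intros a b Ha Hb. apply is_derive_ext_loc with (fun z => G j (p z b)).
    - apply filter_imp with (2 := Hloc a Ha). intros z Hz. symmetry.
      apply is_derive_unique. apply (Dj U G HU); auto.
    - apply (Di (G j) (fun i => H i j)); auto. }
  assert (Eji : forall a b, Rabs a < r -> Rabs b < r ->
    is_derive (fun z => Derive (fun t => U (p t z)) a) b (H j i (p a b))).
  { intros a b Ha Hb. apply is_derive_ext_loc with (fun z => G i (p a z)).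
    - apply filter_imp with (2 := Hloc b Hb). intros z Hz. symmetry.
      apply is_derive_unique. apply (Di U G HU); auto.
    - apply (Dj (G i) (fun j => H j i)); auto. }
  assert (R0 : Rabs 0 < r) by (rewrite Rabs_R0; exact Hr).
  assert (p00 : p 0 0 = x) by (unfold p; now rewrite !shift_0).
  assert (Hcont : forall K (D2 : R -> R -> R), space_cont n O K ->
    (forall a b, Rabs a < r -> Rabs b < r -> D2 a b = K (p a b)) -> continuity_2d_pt D2 0 0).
  { intros K D2 HK E eps. destruct (HK x Hx eps (cond_pos eps)) as (d & Hd & HKd).
    assert (Hm : 0 < Rmin r d) by (apply Rmin_pos; auto).
    exists (mkposreal _ Hm). simpl. intros a b Ha Hb. rewrite Rminus_0_r in Ha, Hb.
    assert (H1 := Rmin_l r d). assert (H2 := Rmin_r r d).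
    rewrite !E, p00; try lra. apply HKd; [apply HpO; lra|apply Hnear; lra]. }
  assert (S := Schwarz (fun a b => U (p a b)) 0 0).
  rewrite <- p00.
  rewrite <- (is_derive_unique _ _ _ (Eij 0 0 R0 R0)).
  rewrite <- (is_derive_unique _ _ _ (Eji 0 0 R0 R0)).
  apply S.
  - exists (mkposreal _ Hr). simpl. intros a b Ha Hb. rewrite Rminus_0_r in Ha, Hb.
    repeat split; eexists.
    + apply (Di U G HU); auto.
    + apply (Dj U G HU); auto.
    + apply Eij; auto.
    + apply Eji; auto.
  - apply Hcont with (H i j); auto. intros a b Ha Hb. apply is_derive_unique, Eij; auto.
  - apply Hcont with (H j i); auto. intros a b Ha Hb. apply is_derive_unique, Eji; auto.
Qed.

(** * Continuity and closures on the cylinder *)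

Lemma cont_on_subset n (D D' : vec -> R -> Prop) f :
  (forall x t, D' x t -> D x t) -> cont_on n D f -> cont_on n D' f.
Proof.
  intros HD Hf x t Hx eps He. destruct (Hf x t (HD _ _ Hx) eps He) as (d & Hd & H).
  exists d. split; auto.
Qed.

Lemma cont_on_minus n D f g :
  cont_on n D f -> cont_on n D g -> cont_on n D (fun x t => f x t - g x t).
Proof.
  intros Hf Hg x t Hx eps He.
  destruct (Hf x t Hx (eps / 2)) as (d1 & Hd1 & H1); [lra|].
  destruct (Hg x t Hx (eps / 2)) as (d2 & Hd2 & H2); [lra|].
  exists (Rmin d1 d2). split; [apply Rmin_pos; auto|]. intros y s Hy Hys.
  specialize (H1 y s Hy (Rlt_le_trans _ _ _ Hys (Rmin_l _ _))).
  specialize (H2 y s Hy (Rlt_le_trans _ _ _ Hys (Rmin_r _ _))).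
  apply Rabs_def2 in H1. apply Rabs_def2 in H2. apply Rabs_def1; lra.
Qed.

Lemma time_le_pdist n x t y s : Rabs (t - s) <= pdist n x t y s.
Proof.
  unfold pdist. rewrite <- sqrt_Rsqr_abs. apply sqrt_le_1_alt.
  assert (0 <= sqnorm n (fun i => x i - y i)) by (apply vsum_nonneg; intros; apply pow2_ge_0).
  unfold Rsqr. lra.
Qed.

Lemma cont_on_time n D c : 0 < c -> cont_on n D (fun _ t => c * t).
Proof.
  intros Hc x t _ eps He. exists (eps / c). split; [apply Rdiv_lt_0_compat; auto|].
  intros y s _ Hys. assert (H := time_le_pdist n y s x t).
  replace (c * s - c * t) with (c * (s - t)) by ring.
  rewrite Rabs_mult, (Rabs_pos_eq c) by lra.
  replace eps with (c * (eps / c)) by (field; lra). apply Rmult_lt_compat_l; lra.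
Qed.

Lemma closure_near_closed n O x : in_Rn n x ->
  (forall d, 0 < d -> exists y, closure n O y /\ near n d y x) -> closure n O x.
Proof.
  intros Hx H. split; [exact Hx|]. intros r Hr.
  destruct (near_dist n r Hr) as (d & Hd & Hn).
  destruct (H (d / 2)) as (y & [_ Hy] & Hyx); [lra|].
  destruct (Hy (d / 2)) as (z & Hz & Hyz); [lra|].
  exists z. split; [exact Hz|]. apply Hn. intros i Hi.
  specialize (Hyx i Hi). assert (H1 := coord_le_dist n y z i Hi).
  apply Rabs_def2 in Hyx.
  assert (H2 : Rabs (y i - z i) < d / 2) by lra. apply Rabs_def2 in H2.
  apply Rabs_def1; lra.
Qed.

Lemma closure_bounded n O : bounded_set n O ->
  exists M, 0 <= M /\ forall x, closure n O x -> forall i, (i < n)%nat -> Rabs (x i) <= M.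
Proof.
  intros [M HM]. exists (Rabs M + 1). split; [assert (H := Rabs_pos M); lra|].
  intros x [_ Hx] i Hi.
  destruct (Hx 1 Rlt_0_1) as (y & Hy & Hxy).
  assert (H1 := coord_le_dist n x y i Hi).
  assert (H2 := coord_le_dist n y (fun _ => 0) i Hi). simpl in H2.
  assert (H3 := HM y Hy). assert (H4 := Rle_abs M). rewrite Rminus_0_r in H2.
  replace (x i) with (x i - y i + y i) by ring.
  eapply Rle_trans; [apply Rabs_triang|]. lra.
Qed.

Lemma subset_closure n O x : open_in n O -> O x -> closure n O x.
Proof.
  intros Ho Hx. split; [apply Ho, Hx|]. intros r Hr. exists x. split; [exact Hx|].
  destruct (near_dist n r Hr) as (d & Hd & Hn). apply Hn. intros i _.
  rewrite Rminus_diag, Rabs_R0. exact Hd.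
Qed.

Lemma space_cont_QT n O T f t : cont_on n (QT O T) f -> 0 < t < T ->
  space_cont n O (fun x => f x t).
Proof.
  intros Hf Ht x Hx eps He.
  destruct (cont_on_near n _ f x t Hf (conj Hx Ht) eps He) as (d & Hd & H).
  exists d. split; [exact Hd|]. intros y Hy Hn. apply H; auto.
  - split; auto.
  - rewrite Rminus_diag, Rabs_R0. exact Hd.
Qed.

(** * The comparison argument at a maximum point *)

Section Comparison.
Variables (n m : nat) (Omega : vec -> Prop) (T : R) (v w : vec -> R -> R)
  (vx wx : nat -> vec -> R -> R) (vxx wxx : nat -> nat -> vec -> R -> R)
  (vt wt : vec -> R -> R).
Hypothesis Omega_open : open_in n Omega.
Hypothesis m_range : (1 <= m <= n)%nat.
Hypothesis v_C21 : is_C21 n (QT Omega T) v vx vxx vt.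
Hypothesis w_C21 : is_C21 n (QT Omega T) w wx wxx wt.

(** Space is compared at the same time and time only backwards, as a maximum at the last time
    allows. The latter gives [wt - vt >= eps], hence the strict inequality [- wt < - vt]. *)
Lemma Ep_lt_at_max x t eps : QT Omega T x t -> 0 < eps ->
  in_Kev n m (- wt x t) (fun i j => wxx i j x t) ->
  (forall y, Omega y -> w y t - v y t <= w x t - v x t) ->
  (forall s, 0 < s < t -> w x s - v x s - eps * s <= w x t - v x t - eps * t) ->
  Ep n m (- wt x t) (fun i j => wxx i j x t) < Ep n m (- vt x t) (fun i j => vxx i j x t).
Proof.
  intros [Hx Ht] He HK Hspace Htime.
  destruct v_C21 as (_ & vxc & vxxc & _ & dv).
  destruct w_C21 as (_ & wxc & wxxc & _ & dw).
  assert (Hd : forall y, Omega y -> QT Omega T y t) by (intros y Hy; split; auto).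
  assert (Pv : partials n Omega (fun y => v y t) (fun i y => vx i y t)).
  { intros y i Hy Hi. apply (dv y t (Hd y Hy)); auto. }
  assert (Pw : partials n Omega (fun y => w y t) (fun i y => wx i y t)).
  { intros y i Hy Hi. apply (dw y t (Hd y Hy)); auto. }
  assert (Pvx : forall j, (j < n)%nat ->
    partials n Omega (fun y => vx j y t) (fun i y => vxx i j y t)).
  { intros j Hj y i Hy Hi. apply (dv y t (Hd y Hy)); auto. }
  assert (Pwx : forall j, (j < n)%nat ->
    partials n Omega (fun y => wx j y t) (fun i y => wxx i j y t)).
  { intros j Hj y i Hy Hi. apply (dw y t (Hd y Hy)); auto. }
  assert (Sv : forall i j, (i < n)%nat -> (j < n)%nat -> vxx i j x t = vxx j i x t).
  { intros i j Hi Hj.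
    apply (hessian_sym n Omega (fun y => v y t) (fun i y => vx i y t) (fun i j y => vxx i j y t)); auto.
    intros a b Ha Hb. apply space_cont_QT with T; auto. }
  assert (Sw : forall i j, (i < n)%nat -> (j < n)%nat -> wxx i j x t = wxx j i x t).
  { intros i j Hi Hj.
    apply (hessian_sym n Omega (fun y => w y t) (fun i y => wx i y t) (fun i j y => wxx i j y t)); auto.
    intros a b Ha Hb. apply space_cont_QT with T; auto. }
  apply EvolutionaryCone.Ep_increasing; auto; try apply m_range.
  - intros xi.
    assert (H : vsum n (fun j => vsum n (fun i => xi i * xi j * (wxx i j x t - vxx i j x t))) <= 0).
    { apply (hessian_max n Omega (fun y => w y t - v y t) (fun i y => wx i y t - vx i y t)
        (fun i j y => wxx i j y t - vxx i j y t) x xi); auto.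
      - intros y i Hy Hi.
        apply (derivable_pt_lim_minus (fun h => w (shift y i h) t)); auto.
      - intros j Hj y i Hy Hi.
        apply (derivable_pt_lim_minus (fun h => wx j (shift y i h) t)).
        + apply Pwx; auto.
        + apply Pvx; auto.
      - intros i Hi. apply (space_cont_QT n Omega T (fun y s => wx i y s - vx i y s)); auto.
        apply cont_on_minus; auto.
      - intros i j Hi Hj.
        apply (space_cont_QT n Omega T (fun y s => wxx i j y s - vxx i j y s)); auto.
        apply cont_on_minus; auto. }
    fold (vsum n (fun i => vsum n (fun j => xi i * xi j * (vxx i j x t - wxx i j x t)))).
    set (q := vsum n (fun j => vsum n (fun i => xi i * xi j * (wxx i j x t - vxx i j x t)))) in H.
    (* The two double sums differ by the sign and by a transposition of the indices, which the
       symmetry of both Hessians absorbs. *)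
    apply Rle_trans with (-1 * q); [lra|right]. unfold q.
    rewrite <- vsum_scal. apply vsum_ext. intros i Hi.
    rewrite <- vsum_scal. apply vsum_ext. intros j Hj.
    rewrite (Sv i j), (Sw i j) by auto. ring.
  - assert (H : 0 <= wt x t - vt x t - eps).
    { apply (derivative_at_left_max (fun s => w x s - v x s - eps * s) t _ t); [lra| |].
      - apply (derivable_pt_lim_minus (fun s => w x s - v x s)).
        + apply (derivable_pt_lim_minus (fun s => w x s)); [apply dw|apply dv]; split; auto.
        + replace eps with (eps * 1) at 2 by ring.
          apply (derivable_pt_lim_scal (fun s => s)), derivable_pt_lim_id.
      - intros s Hs. apply Htime. lra. }
    lra.
Qed.
End Comparison.

Theorem theorem3p6 (n m : nat) (Omega : vec -> Prop) (T : R)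
  (v w : vec -> R -> R)
  (vx wx : nat -> vec -> R -> R) (vxx wxx : nat -> nat -> vec -> R -> R)
  (vt wt : vec -> R -> R) :
  is_domain n Omega -> bounded_set n Omega -> (1 <= m <= n)%nat -> 0 < T ->
  cont_on n (QTbar n Omega T) v -> cont_on n (QTbar n Omega T) w ->
  is_C21 n (QT Omega T) v vx vxx vt ->
  is_C21 n (QT Omega T) w wx wxx wt ->
  (forall x t, QT Omega T x t -> in_Kev n m (- wt x t) (fun i j => wxx i j x t)) ->
  (forall x t, QT Omega T x t ->
     Ep n m (- vt x t) (fun i j => vxx i j x t)
     - Ep n m (- wt x t) (fun i j => wxx i j x t) <= 0) ->
  (forall x t, parbdry n Omega T x t -> w x t - v x t <= 0) ->
  forall x t, QTbar n Omega T x t -> w x t <= v x t.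
Proof.
  intros (Ho & _ & _) Hb Hm HT Hvc Hwc Hv Hw HK HE Hbd.
  (* With [t1 < T] an interior maximum point at the last time [t1] still lies in [QT], where the
     derivatives exist. *)
  assert (Hbefore : forall x t, closure n Omega x -> 0 <= t < T -> w x t <= v x t).
  { intros x1 t1 Hx1 Ht1. apply Rnot_lt_le. intros Hlt.
    (* Subtracting [eps * t] costs at most [eps * T], half of the gap at [(x1, t1)], so the maximum
       stays positive. *)
    set (eps := (w x1 t1 - v x1 t1) / (2 * T)).
    assert (He : 0 < eps) by (apply Rdiv_lt_0_compat; lra).
    assert (HeT : eps * T = (w x1 t1 - v x1 t1) / 2) by (unfold eps; field; lra).
    set (D := fun x t => closure n Omega x /\ 0 <= t <= t1).
    assert (HD : forall x t, D x t -> QTbar n Omega T x t).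
    { intros x t [Hx Ht]. split; [exact Hx|lra]. }
    destruct (closure_bounded n Omega Hb) as (M & HM0 & HM).
    destruct (maximum_attained n D (fun x t => w x t - v x t - eps * t) (Rmax M T))
      as (x0 & t0 & [Hx0 Ht0] & Hmax).
    - intros x t [Hx Ht]. assert (H1 := Rmax_l M T). assert (H2 := Rmax_r M T). split.
      + rewrite Rabs_pos_eq; lra.
      + intros i Hi. apply Rle_trans with M; auto.
    - intros x t Hx H. split.
      + apply closure_near_closed; auto. intros d Hd.
        destruct (H d Hd) as (y & s & [Hy _] & Hn & _). exists y. auto.
      + split; apply Rnot_lt_le; intros Hc.
        * destruct (H (- t)) as (y & s & [_ Hs] & _ & Hst); [lra|].
          apply Rabs_def2 in Hst. lra.
        * destruct (H (t - t1)) as (y & s & [_ Hs] & _ & Hst); [lra|].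
          apply Rabs_def2 in Hst. lra.
    - apply cont_on_minus; [|apply cont_on_time, He].
      apply cont_on_minus; apply cont_on_subset with (QTbar n Omega T); auto.
    - exists x1, t1. split; [exact Hx1|lra].
    - assert (H1 := Hmax x1 t1 (conj Hx1 (conj (proj1 Ht1) (Rle_refl t1)))).
      assert (Hpos : 0 < w x0 t0 - v x0 t0).
      { assert (0 <= eps * t0) by (apply Rmult_le_pos; lra).
        assert (eps * t1 <= eps * T) by (apply Rmult_le_compat_l; lra). lra. }
      assert (HO : Omega x0).
      { apply NNPP. intros Hn. 
        assert (H2 : parbdry n Omega T x0 t0) by (right; split; [split; auto|lra]).
        specialize (Hbd x0 t0 H2). lra. }
      assert (Ht0' : 0 < t0).
      { apply Rnot_le_lt. intros Hn. assert (E : t0 = 0) by lra.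
        specialize (Hbd x0 t0 (or_introl (conj HO E))). lra. }
      assert (HQ : QT Omega T x0 t0) by (split; [exact HO|lra]).
      assert (H2 := Ep_lt_at_max n m Omega T v w vx wx vxx wxx vt wt Ho Hm Hv Hw
        x0 t0 eps HQ He (HK x0 t0 HQ)).
      specialize (HE x0 t0 HQ). apply (Rlt_irrefl (Ep n m (- wt x0 t0) (fun i j => wxx i j x0 t0))).
      eapply Rlt_le_trans; [apply H2|lra].
      + intros y Hy. specialize (Hmax y t0 (conj (subset_closure n Omega y Ho Hy) Ht0)). lra.
      + intros s Hs. apply Hmax. split; [exact Hx0|lra]. }
  (* At [t = T] a positive gap would persist, by continuity, at [T - h] for small [h], against the
     case already settled. *)
  intros x t [Hx Ht]. destruct (Rlt_le_dec t T) as [Hlt|Hge]; [apply Hbefore; auto; lra|].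
  assert (t = T) by lra. subst t. apply Rnot_lt_le. intros Hlt.
  destruct (cont_on_near n _ _ x T (cont_on_minus n _ w v Hwc Hvc) (conj Hx Ht) (w x T - v x T))
    as (d & Hd & H); [lra|].
  set (h := Rmin (d / 2) T). assert (Hh : 0 < h) by (apply Rmin_pos; lra).
  assert (Hhd : h <= d / 2) by apply Rmin_l. assert (HhT : h <= T) by apply Rmin_r.
  specialize (Hbefore x (T - h) Hx ltac:(lra)).
  assert (HQ : QTbar n Omega T x (T - h)) by (split; [exact Hx|lra]).
  specialize (H x (T - h) HQ).
  assert (Hn : near n d x x) by (intros i _; rewrite Rminus_diag, Rabs_R0; exact Hd).
  specialize (H Hn ltac:(apply Rabs_def1; lra)). apply Rabs_def2 in H. lra.
Qed.
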